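(* Let $A$ be a material coefficient field as in the context, let $\boldsymbol N\in\mathbb N^d$ have all components odd, and let $\overline A,\underline A\in L^\infty_\#(\mathcal Y;\mathbb R^{d\times d})$ be symmetric, with $\underline A$ uniformly elliptic, such that $$\underline A(x)\preceq A(x)\preceq\overline A(x)\quad\text{for almost all }x\in\mathcal Y.$$ Put $\overline a(u,v)=(\overline A u,v)_{L^2_\#}$ and $\underline a^{-1}(u,v)=(\underline A^{-1}u,v)_{L^2_\#}$ on $L^2_\#(\mathcal Y;\mathbb R^d)$, and let the symmetric matrices $\overline A_{\mathrm H},\overline B_{\mathrm H},\overline A_{\mathrm H,\boldsymbol N},\overline B_{\mathrm H,\boldsymbol N},\overline{\widetilde A}_{\mathrm H,\boldsymbol N},\overline{\widetilde B}_{\mathrm H,\boldsymbol N}\in\mathbb R^{d\times d}$ be defined by requiring, for all $E,J\in\mathbb R^d$, $$\overline A_{\mathrm H}E\cdot E=\inf_{e\in\mathcal E}\overline a(E+e,E+e),\qquad \overline B_{\mathrm H}J\cdot J=\inf_{j\in\mathcal J}\underline a^{-1}(J+j,J+j),$$ $$\overline A_{\mathrm H,\boldsymbol N}E\cdot E=\inf_{e\in\mathcal E_{\boldsymbol N}}\overline a(E+e,E+e),\qquad \overline B_{\mathrm H,\boldsymbol N}J\cdot J=\inf_{j\in\mathcal J_{\boldsymbol N}}\underline a^{-1}(J+j,J+j),$$ $$\overline{\widetilde A}_{\mathrm H,\boldsymbol N}E\cdot E=\overline a(E+\widetilde e^{(E)}_{\boldsymbol N},E+\widetilde e^{(E)}_{\boldsymbol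 N}),\qquad \overline{\widetilde B}_{\mathrm H,\boldsymbol N}J\cdot J=\underline a^{-1}(J+\widetilde\jmath^{(J)}_{\boldsymbol N},J+\widetilde\jmath^{(J)}_{\boldsymbol N}),$$ where $\widetilde e^{(E)}_{\boldsymbol N},\widetilde\jmath^{(J)}_{\boldsymbol N}$ are the minimizers of the Galerkin scheme with numerical integration (for $A$) defined in the context. Then $$\overline{\widetilde B}_{\mathrm H,\boldsymbol N}^{-1}\preceq\overline B_{\mathrm H,\boldsymbol N}^{-1}\preceq\overline B_{\mathrm H}^{-1}\preceq B_{\mathrm H}^{-1}=A_{\mathrm H}\preceq\overline A_{\mathrm H}\preceq\overline A_{\mathrm H,\boldsymbol N}\preceq\overline{\widetilde A}_{\mathrm H,\boldsymbol N}$$ and $$\overline B_{\mathrm H,\boldsymbol N}^{-1}\preceq B_{\mathrm H,\boldsymbol N}^{-1}\preceq B_{\mathrm H}^{-1}=A_{\mathrm H}\preceq A_{\mathrm H,\boldsymbol N}\preceq\overline A_{\mathrm H,\boldsymbol N}.$$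
   Context: Let $d\in\{2,3\}$, $\mathcal Y=(-\tfrac12,\tfrac12)^d$. Functions on $\mathcal Y$ are understood as $\mathcal Y$-periodic (period lattice $\mathbb Z^d$); $L^p_\#(\mathcal Y;X)$ is the space of $\mathcal Y$-periodic $X$-valued $L^p$ functions, and $(u,v)_{L^2_\#}=\int_{\mathcal Y}u(x)\cdot v(x)\,dx$ on $L^2_\#(\mathcal Y;\mathbb R^d)$. Put $\varphi_k(x)=\exp(2\pi i\,k\cdot x)$, $\hat v(k)=\int_{\mathcal Y}v(x)\varphi_{-k}(x)\,dx$ for $k\in\mathbb Z^d$, and $\langle v\rangle=\hat v(0)$. Subspaces: $\mathcal E$ is the set of $v\in L^2_\#(\mathcal Y;\mathbb R^d)$ with $\langle v\rangle=0$ and $\operatorname{curl}v=0$, i.e. $k_\beta\hat v_\alpha(k)-k_\alpha\hat v_\beta(k)=0$ for all $k,\alpha,\beta$; $\mathcal J$ is the set of $v\in L^2_\#(\mathcal Y;\mathbb R^d)$ with $\langle v\rangle=0$ and $\operatorname{div}v=0$, i.e. $k\cdot\hat v(k)=0$ for all $k$. Vectors in $\mathbb R^d$ are identified with constant functions. Coefficients: $A:\mathcal Y\to\mathbb R^{d\times d}_{\mathrm{spd}}$ ($\mathbb R^{d\times d}_{\mathrm{spd}}$ = symmetric positive definite matrices) is in $L^\infty_\#$ and there are $0<c_A\le C_A<\infty$ with $c_A\|v\|^2\le A(x)v\cdot v\le C_A\|v\|^2$ for a.e. $x$ and all $v\in\mathbb R^d$; moreover, so that the scheme with numerical integration below makes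 sense, $A$ is Riemann integrable or continuous. ''Uniformly elliptic'' for a symmetric field $\underline A$ means: there is $c>0$ with $c\|v\|^2\le\underline A(x)v\cdot v$ for a.e. $x$ and all $v\in\mathbb R^d$. Bilinear forms on $L^2_\#(\mathcal Y;\mathbb R^d)$: $a(u,v)=(Au,v)_{L^2_\#}$, $a^{-1}(u,v)=(A^{-1}u,v)_{L^2_\#}$. Trigonometric polynomials: for $\boldsymbol N\in\mathbb N^d$ with all $N_\alpha$ odd, $\mathbb Z^d_{\boldsymbol N}=\{k\in\mathbb Z^d:-N_\alpha/2\le k_\alpha<N_\alpha/2\}$, $\mathcal T^d_{\boldsymbol N}=\{\sum_{k\in\mathbb Z^d_{\boldsymbol N}}c_k\varphi_k:\ c_k=\overline{c_{-k}}\in\mathbb C^d\}$, $\mathcal E_{\boldsymbol N}=\mathcal E\cap\mathcal T^d_{\boldsymbol N}$, $\mathcal J_{\boldsymbol N}=\mathcal J\cap\mathcal T^d_{\boldsymbol N}$. Grid points: $x_{\boldsymbol N}^k=(k_\alpha/N_\alpha)_\alpha$, $k\in\mathbb Z^d_{\boldsymbol N}$. The symmetric matrices $A_{\mathrm H},B_{\mathrm H},A_{\mathrm H,\boldsymbol N},B_{\mathrm H,\boldsymbol N}\in\mathbb R^{d\times d}$ satisfy, for all $E,J\in\mathbb R^d$: $A_{\mathrm H}E\cdot E=\min_{e\in\mathcal E}a(E+e,E+e)$, $B_{\mathrm H}J\cdot J=\min_{j\in\mathcal J}a^{-1}(J+j,J+j)$, $A_{\mathrm H,\boldsymbol N}E\cdot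 E=\inf_{e\in\mathcal E_{\boldsymbol N}}a(E+e,E+e)$, $B_{\mathrm H,\boldsymbol N}J\cdot J=\inf_{j\in\mathcal J_{\boldsymbol N}}a^{-1}(J+j,J+j)$. Galerkin scheme with numerical integration: with $\widetilde a_{\boldsymbol N}(u,v)=\sum_{k\in\mathbb Z^d_{\boldsymbol N}}A(x^k_{\boldsymbol N})u(x^k_{\boldsymbol N})\cdot v(x^k_{\boldsymbol N})$ and $\widetilde a_{\boldsymbol N}^{-1}(u,v)=\sum_{k\in\mathbb Z^d_{\boldsymbol N}}A^{-1}(x^k_{\boldsymbol N})u(x^k_{\boldsymbol N})\cdot v(x^k_{\boldsymbol N})$ on $\mathcal T^d_{\boldsymbol N}$, $\widetilde e^{(E)}_{\boldsymbol N}\in\mathcal E_{\boldsymbol N}$ is the minimizer of $e\mapsto\widetilde a_{\boldsymbol N}(E+e,E+e)$ over $\mathcal E_{\boldsymbol N}$ and $\widetilde\jmath^{(J)}_{\boldsymbol N}\in\mathcal J_{\boldsymbol N}$ is the minimizer of $j\mapsto\widetilde a^{-1}_{\boldsymbol N}(J+j,J+j)$ over $\mathcal J_{\boldsymbol N}$. Löwner order: for symmetric $L,M\in\mathbb R^{d\times d}$, $L\preceq M$ means $Lu\cdot u\le Mu\cdot u$ for all $u\in\mathbb R^d$. *)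

(* Defs.v *)
From HB Require Import structures.
From mathcomp Require Import all_boot all_order all_algebra.
From mathcomp Require Import all_classical all_reals all_analysis.
From mathcomp Require Import complex.
Import Order.TTheory GRing.Theory Num.Theory.
Import numFieldNormedType.Exports.

Set Implicit Arguments.
Unset Strict Implicit.
Unset Printing Implicit Defensive.

Local Open Scope classical_set_scope.
Local Open Scope ring_scope.
Local Open Scope complex_scope.

Section unit_interval.
Context {R : realType}.

Definition unit_itv : set (measurableTypeR R) := `](- 2^-1), 2^-1[%classic.

Lemma measurable_unit_itv : measurable unit_itv.
Proof. exact: measurable_itv. Qed.

Definition itv_measure : set (measurableTypeR R) -> \bar R :=
  mrestr (@lebesgue_measure R) measurable_unit_itv.

HB.instance Definition _ := Measure.on itv_measure.

Lemma itv_measure_setT : itv_measure setT = 1%E.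
Proof.
rewrite /itv_measure /mrestr setTI lebesgue_measure_itv /= lte_fin.
by rewrite gtrN ?invr_gt0 ?ltr0n// opprK -EFinD -mulr2n -[_ *+ 2]mulr_natr mulVf ?pnatr_eq0.
Qed.

HB.instance Definition _ :=
  Measure_isProbability.Build _ _ _ itv_measure itv_measure_setT.

Definition tuple_cons (n : nat) (p : measurableTypeR R * n.-tuple R) : n.+1.-tuple R :=
  [tuple of (p.1 : R) :: p.2].

Lemma measurable_tuple_cons (n : nat) :
  measurable_fun [set: measurableTypeR R * n.-tuple R] (@tuple_cons n).
Proof. exact: measurable_cons. Qed.

HB.instance Definition _ (n : nat) := isMeasurableFun.Build _ _ _ _
  (@tuple_cons n) (@measurable_tuple_cons n).

End unit_interval.

(* Lebesgue measure of R^n restricted to the open cube ]-1/2, 1/2[^n *)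
Fixpoint cell_measure (R : realType) (n : nat) : probability (n.-tuple R) R :=
  match n with
  | 0 => \d_([tuple] : 0.-tuple R)
  | n'.+1 => distribution (itv_measure \x cell_measure R n')%E
               (@tuple_cons R n')
  end.

Section homogenization.
Context {R : realType} {d : nat}.

Local Notation point := (d.-tuple R).
Local Notation index := 'cV[int]_d.
Local Notation vec := 'cV[R]_d.
Local Notation mat := 'M[R]_d.
Local Notation vfield := (d.-tuple R -> 'cV[R]_d).
Local Notation mfield := (d.-tuple R -> 'M[R]_d).
Local Notation mu := (cell_measure R d).

Definition dotv (u v : vec) : R := \sum_(a < d) u a 0 * v a 0.

Definition qform (M : mat) (u : vec) : R := dotv (M *m u) u.

Definition symm (M : mat) : Prop := M^T = M.

Definition spd (M : mat) : Prop :=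
  symm M /\ forall u : vec, u != 0 -> 0 < qform M u.

Definition loewner (L M : mat) : Prop := forall u : vec, qform L u <= qform M u.

Definition shift (x : point) (k : index) : point :=
  [tuple tnth x a + (k a 0)%:~R | a < d].

Definition periodic (T : Type) (f : point -> T) : Prop :=
  forall x k, f (shift x k) = f x.

(* [Lfun] consists of Borel functions; agreeing a.e. with a Borel function is
   Lebesgue measurability. *)
Definition Lp_cell (p : \bar R) (f : point -> R) : Prop :=
  exists2 g : point -> R, g \in Lfun mu p & {ae mu, forall x, f x = g x}.

Definition L2per (v : vfield) : Prop :=
  periodic v /\ forall a, Lp_cell 2%:E (fun x => v x a 0).

Definition Linfper (A : mfield) : Prop :=
  periodic A /\ forall a b, Lp_cell +oo%E (fun x => A x a b).

Definition bform (A : mfield) (u v : vfield) : R :=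
  \int[mu]_x dotv (A x *m u x) (v x).

Definition inv_field (A : mfield) : mfield := fun x => invmx (A x).

Definition phase (k : index) (x : point) : R :=
  2 * pi * \sum_(a < d) (k a 0)%:~R * tnth x a.

(* exp (2 i pi k . x) *)
Definition phi (k : index) (x : point) : R[i] :=
  cos (phase k x) +i* sin (phase k x).

Definition cintegral (f : point -> R[i]) : R[i] :=
  (\int[mu]_x complex.Re (f x)) +i* (\int[mu]_x complex.Im (f x)).

Definition fourier (v : vfield) (k : index) : 'cV[R[i]]_d :=
  \col_a cintegral (fun x => (v x a 0)%:C * phi (- k) x).

Definition curl_free (v : vfield) : Prop := forall (k : index) (a b : 'I_d),
  (k b 0)%:~R * fourier v k a 0 - (k a 0)%:~R * fourier v k b 0 = 0.

Definition div_free (v : vfield) : Prop := forall k : index,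
  \sum_(a < d) (k a 0)%:~R * fourier v k a 0 = 0.

Definition Esp : set vfield :=
  [set v | [/\ L2per v, fourier v 0 = 0 & curl_free v]].

Definition Jsp : set vfield :=
  [set v | [/\ L2per v, fourier v 0 = 0 & div_free v]].

Section trigonometric_polynomials.
Variable N : 'I_d -> nat.

(* - N_a / 2 <= k_a < N_a / 2 *)
Definition ZN : set index :=
  [set k | forall a, - (N a)%:Z <= 2 * k a 0 < (N a)%:Z].

Definition TN : set vfield :=
  [set v | exists2 c : index -> 'cV[R[i]]_d,
     forall k a, k \in ZN -> c k a 0 = conjc (c (- k) a 0) &
     forall x a, (v x a 0)%:C = \sum_(k \in ZN) c k a 0 * phi k x].

Definition EN : set vfield := Esp `&` TN.
Definition JN : set vfield := Jsp `&` TN.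

Definition grid (k : index) : point :=
  [tuple (k a 0)%:~R / (N a)%:R | a < d].

Definition gni_form (A : mfield) (u v : vfield) : R :=
  \sum_(k \in ZN) dotv (A (grid k) *m u (grid k)) (v (grid k)).

End trigonometric_polynomials.

Definition energy (f : vfield -> vfield -> R) (E : vec) (e : vfield) : R :=
  f (fun x => E + e x) (fun x => E + e x).

Definition is_minimizer (S : set vfield) (F : vfield -> R) (e : vfield) : Prop :=
  S e /\ forall e', S e' -> F e <= F e'.

Definition homog_min (f : vfield -> vfield -> R) (S : set vfield) (M : mat) :
    Prop :=
  symm M /\ forall E, exists2 e, is_minimizer S (energy f E) e &
    qform M E = energy f E e.

Definition homog_inf (f : vfield -> vfield -> R) (S : set vfield) (M : mat) :
    Prop :=
  symm M /\ forall E, qform M E = inf [set energy f E e | e in S].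

Definition homog_at (f : vfield -> vfield -> R) (e : vec -> vfield) (M : mat) :
    Prop :=
  symm M /\ forall E, qform M E = energy f E (e E).

(* Convergence of the Riemann sums over the closed cell: in direction a the
   subdivision is - 1/2 = s a 0 <= ... <= s a n = 1/2, of mesh at most delta,
   and t k is the tag of the box with multi-index k.  Repeated nodes are
   allowed, so that taking the same n in all directions is no restriction. *)
Definition riemann_integrable (f : point -> R) : Prop :=
  exists I : R, forall eps : R, 0 < eps -> exists2 delta : R, 0 < delta &
  forall (n : nat) (s : 'I_d -> nat -> R) (t : {ffun 'I_d -> 'I_n} -> point),
    (forall a, s a 0%N = - 2^-1 /\ s a n = 2^-1) ->
    (forall a (i : 'I_n), s a i <= s a i.+1 <= s a i + delta) ->
    (forall (k : {ffun 'I_d -> 'I_n}) a,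
       s a (k a) <= tnth (t k) a <= s a (k a).+1) ->
    `|\sum_k f (t k) * \prod_(a < d) (s a (k a).+1 - s a (k a)) - I| < eps.

Definition continuous_field (A : mfield) : Prop :=
  continuous (fun y : 'cV[R]_d => A [tuple y a 0 | a < d]).

Definition unif_elliptic (A : mfield) : Prop :=
  exists2 c : R, 0 < c &
    {ae mu, forall x, forall v : vec, c * dotv v v <= qform (A x) v}.

Definition material (A : mfield) : Prop :=
  [/\ Linfper A,
      forall x, spd (A x),
      exists c C : R, [/\ 0 < c, c <= C &
        {ae mu, forall x, forall v : vec,
          c * dotv v v <= qform (A x) v <= C * dotv v v}] &
      continuous_field A \/
      forall a b, riemann_integrable (fun x => A x a b)].

End homogenization.

(* Main.v *)
(** All inequalities except [invmx BH = AH] come from comparing infima: the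
   minimum over a smaller set of trial fields, or of a pointwise larger form, is
   larger, and inversion reverses the Loewner order of positive definite
   matrices.  The identity is the duality of the primal and the dual problem.
   If [e] minimizes the primal energy then [A (E + e)] is orthogonal to all
   gradient fields, hence is a constant [J] plus a divergence-free field; it has
   the same energy, so that the dual minimum at [J] is at most the primal one
   at [E].  Conversely, integrating
   [2 p . q <= A p . p + A^-1 q . q] with [p = E + e] and [q = J + j] gives
   [2 E . J <= AH E . E + BH J . J], because gradient fields and
   divergence-free fields are orthogonal.  This orthogonality is read off the
   Fourier coefficients by Parseval's formula, which needs the density of
   trigonometric polynomials in L2.  Density: the sets whose indicator is an L2
   limit of trigonometric polynomials form a sigma-algebra, and they contain
   each half space, which up to a null set is the positivity set of a
   trigonometric polynomial. *)

Require Import Defs.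
From HB Require Import structures.
From mathcomp Require Import all_boot all_order all_algebra.
From mathcomp Require Import all_classical all_reals all_analysis.
From mathcomp Require Import measurable_realfun ess_sup_inf complex ring lra.
Import Order.TTheory GRing.Theory Num.Theory.
Import numFieldNormedType.Exports.

Set Implicit Arguments.
Unset Strict Implicit.
Unset Printing Implicit Defensive.

Local Open Scope classical_set_scope.
Local Open Scope ring_scope.

(** * Integrals of functions that are only almost everywhere Borel *)

(** The fields are only almost everywhere equal to Borel functions, so the rules of integration are
    redone for the class [Lae], and approximation is measured by squared L2 distances. Projections
    onto closed subspaces and the Helmholtz decomposition are replaced by finite Fourier partial
    sums and by tests against single gradient modes. In the density argument, the polynomials [thr],
    akin to those in the Brosowski-Deutsch proof of the Stone-Weierstrass theorem, turn an element p
    of the algebra with |p| <= 1 into the indicator of p > 0. Half spaces suffice because the rays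
    generate the Borel sets of each coordinate. A real [inf] is informative only on a nonempty set
    that is bounded below. The lower bound comes from ellipticity and the zero mean of the trial
    fields; nonemptiness comes from the minimizers of the scheme with numerical integration, which
    are also the trial fields behind the outermost inequalities of the first chain. Inverting the
    order needs positive definite dual matrices: the bound A <= C gives every dual energy at J the
    lower bound |J|^2 / C. *)

Section ae_integral.
Context {disp : measure_display} {T : measurableType disp} {R : realType}.
Variable mu : probability T R.
Implicit Types f g h : T -> R.

Import HBNNSimple.

(* [f] and [g] need not be measurable, so [ae_eq_integral] does not apply; a
   simple function below [f] is below [g] once it is set to 0 on the null set. *)
Lemma nnintegral_le_off (N : set T) (f g : T -> \bar R) :
  measurable N -> mu N = 0%E -> (forall x, 0 <= f x)%E -> (forall x, 0 <= g x)%E ->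
  (forall x, ~ N x -> f x = g x) -> (\int[mu]_x f x <= \int[mu]_x g x)%E.
Proof.
move=> mN N0 f0 g0 fg; rewrite !ge0_integralTE//.
apply: ge_ereal_sup => _ /= [h hf <-].
have mNC : measurable (~` N) by exact: measurableC.
apply: ereal_sup_ubound => /=; exists (proj_nnsfun h mNC) => /=.
  move=> x; have [Nx|Nx] := pselect (N x).
    by rewrite /= mindicE memNset ?mulr0//; apply.
  by rewrite /= mindicE mem_set// mulr1 -fg.
rewrite -!integralT_nnsfun; apply: ae_eq_integral => //.
- exact/measurable_EFinP.
- exact/measurable_EFinP.
exists N; split => // x /= xN; apply: contrapT => Nx; apply: xN => _ /=.
by rewrite /= mindicE mem_set// mulr1.
Qed.

Lemma ae_eq_integralW (f g : T -> \bar R) :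
  {ae mu, forall x, f x = g x} -> (\int[mu]_x f x = \int[mu]_x g x)%E.
Proof.
move=> [N [mN N0 fgN]].
have fg x : ~ N x -> f x = g x.
  by move=> Nx; apply: contrapT => fgx; apply: Nx; exact: fgN.
rewrite integralE [RHS]integralE; congr (_ - _)%E; apply/eqP; rewrite eq_le;
  apply/andP; split; apply: (@nnintegral_le_off N) => // x Nx;
  by rewrite ?funeposE ?funenegE fg.
Qed.

Lemma ae_eq_Rintegral f g :
  {ae mu, forall x, f x = g x} -> \int[mu]_x f x = \int[mu]_x g x.
Proof.
move=> fg; congr fine; apply: ae_eq_integralW.
by apply: filterS fg => x ->.
Qed.

(** For the cell measure this is convertible to [Lp_cell], so membership in [L2per] and [Linfper]
    can be used directly. *)
Definition Lae (p : \bar R) f :=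
  exists2 g, g \in Lfun mu p & {ae mu, forall x, f x = g x}.

Lemma Lae_eq p f g : {ae mu, forall x, f x = g x} -> Lae p g -> Lae p f.
Proof.
move=> fg [h hL gh]; exists h => //.
by apply: filterS2 fg gh => x -> ->.
Qed.

Lemma LaeD p f g : (1 <= p)%E -> Lae p f -> Lae p g -> Lae p (fun x => f x + g x).
Proof.
move=> p1 [f' f'L ff'] [g' g'L gg']; exists (f' \+ g').
  exact: (Lfun_addr_closed mu p1).2.
by apply: filterS2 ff' gg' => x -> ->.
Qed.

Lemma LaeZ r c f : 1 <= r -> Lae r%:E f -> Lae r%:E (fun x => c * f x).
Proof.
move=> r1 [f' f'L ff']; exists (fun x => f' x * c); first exact: Lfun_scale.
by apply: filterS ff' => x ->; rewrite mulrC.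
Qed.

Lemma Lae_cst r c : Lae r%:E (fun=> c).
Proof. by exists (cst c); [exact: Lfun_cst|apply: aeW]. Qed.

Lemma Lae_sum r I (s : seq I) (F : I -> T -> R) : 1 <= r ->
  (forall i, Lae r%:E (F i)) -> Lae r%:E (fun x => \sum_(i <- s) F i x).
Proof.
move=> r1 FL; elim: s => [|i s IH].
  by under eq_fun do rewrite big_nil; exact: Lae_cst.
by under eq_fun do rewrite big_cons; apply: LaeD.
Qed.

Lemma LaeM f g : Lae 2%:E f -> Lae 2%:E g -> Lae 1 (fun x => f x * g x).
Proof.
move=> [f' f'L ff'] [g' g'L gg']; exists (f' \* g'); first exact: Lfun2_mul_Lfun1.
by apply: filterS2 ff' gg' => x -> ->.
Qed.

Lemma Lfun_measurable p f : f \in Lfun mu p -> measurable_fun setT f.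
Proof. by move=> /sub_Lfun_mfun; rewrite inE. Qed.

Lemma Lfun2P f : measurable_fun setT f ->
  mu.-integrable setT (EFin \o (fun x => f x ^+ 2)) -> f \in Lfun mu 2%:E.
Proof.
move=> mf /integrableP[_ ifoo]; rewrite inE; apply/andP; split; rewrite inE//=.
rewrite /finite_norm unlock poweR_lty//; apply: le_lt_trans ifoo.
rewrite le_eqVlt; apply/orP; left; apply/eqP; apply: eq_integral => x _ /=.
by rewrite powR_mulrn// -normrX.
Qed.

Lemma Lfun_bounded (M : R) f : measurable_fun setT f -> (forall x, `|f x| <= M) ->
  f \in Lfun mu 2%:E.
Proof.
move=> mf fM; apply: Lfun2P => //.
apply: (@le_integrable _ _ _ _ _ measurableT _ (EFin \o cst (M ^+ 2))).
- by apply/measurable_EFinP; exact: measurable_funX.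
- move=> x _ /=; rewrite lee_fin !normrX ler_sqr ?nnegrE//.
  by rewrite (le_trans (fM x))// ler_norm.
- exact: finite_measure_integrable_cst.
Qed.

Lemma Laey_bounded f : Lae +oo f -> exists M : R, exists g : T -> R,
  [/\ measurable_fun setT g, forall x, `|g x| <= M &
      {ae mu, forall x, f x = g x}].
Proof.
move=> [g gL fg]; have mg := Lfun_measurable gL.
have : ('N[mu]_+oo [EFin \o g] < +oo)%E.
  by move: gL; rewrite inE => /andP[_]; rewrite inE.
rewrite unlock; rewrite /= probability_setT lte_fin ltr01 => gy.
have := ess_sup_ge mu (abse \o (EFin \o g)).
set S := ess_sup _ _ in gy * => gS.
(* [gy] excludes the value +oo. The maximum with 0 excludes -oo and makes [M] nonnegative, so that
   cutting [g] to 0 where it exceeds [M] respects the bound everywhere. *)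
pose M := fine (maxe S 0).
have gM : {ae mu, forall x, `|g x| <= M}.
  apply: filterS gS => x /= gx; rewrite -lee_fin fineK.
    by rewrite le_max gx.
  rewrite ge0_fin_numE; last by rewrite le_max lexx orbT.
  by rewrite gt_max gy ltry.
exists M; exists (fun x => if `|g x| <= M then g x else 0); split.
- apply: measurable_fun_ifT => //.
  by apply: measurable_fun_ler => //; exact: measurableT_comp.
- by move=> x; case: ifPn => // _; rewrite normr0 fine_ge0// le_max lexx orbT.
- by apply: filterS2 fg gM => x -> ->.
Qed.

Lemma bounded_Laey (M : R) f g : measurable_fun setT g ->
  {ae mu, forall x, f x = g x} -> {ae mu, forall x, `|f x| <= M} -> Lae +oo f.
Proof.
move=> mg fg fM; exists g => //; rewrite inE; apply/andP; split; rewrite inE//=.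
rewrite /finite_norm unlock /= probability_setT lte_fin ltr01.
apply: (@le_lt_trans _ _ M%:E); last exact: ltry.
apply/ess_supP; apply: filterS2 fg fM => x -> /= gM.
by rewrite lee_fin.
Qed.

Lemma LaeyM f g : Lae +oo f -> Lae 2%:E g -> Lae 2%:E (fun x => f x * g x).
Proof.
move=> /Laey_bounded[M [f' [mf' f'M ff']]] [g' g'L gg'].
have mg' := Lfun_measurable g'L.
exists (f' \* g'); last by apply: filterS2 ff' gg' => x -> ->.
have mfg : measurable_fun setT (f' \* g') by exact: measurable_funM.
apply: Lfun2P => //.
apply: (@le_integrable _ _ _ _ _ measurableT _
   (EFin \o (fun x => M ^+ 2 * g' x ^+ 2))).
- by apply/measurable_EFinP; exact: measurable_funX.
- move=> x _ /=; rewrite lee_fin ger0_norm ?sqr_ge0//.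
  rewrite ger0_norm; last by apply: mulr_ge0; exact: sqr_ge0.
  rewrite (exprMn 2 (f' x) (g' x)) ler_wpM2r ?sqr_ge0//.
  have M0 : 0 <= M by rewrite (le_trans _ (f'M x)).
  by rewrite -[leLHS]real_normK ?num_real// ler_pXn2r ?nnegrE//.
- exact: (integrableZl measurableT (M ^+ 2) (Lfun2_integrable_sqr g'L)).
Qed.

Lemma Rintegral_aeD f g : Lae 1 f -> Lae 1 g ->
  \int[mu]_x (f x + g x) = \int[mu]_x f x + \int[mu]_x g x.
Proof.
move=> [f' f'L ff'] [g' g'L gg'].
rewrite (ae_eq_Rintegral ff') (ae_eq_Rintegral gg') -RintegralD//;
  [|exact/Lfun1_integrable|exact/Lfun1_integrable].
by apply: ae_eq_Rintegral; apply: filterS2 ff' gg' => x -> ->.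
Qed.

Lemma Rintegral_aeZ c f : Lae 1 f ->
  \int[mu]_x (c * f x) = c * \int[mu]_x f x.
Proof.
move=> [f' f'L ff'].
rewrite (ae_eq_Rintegral ff') -RintegralZl//; last exact/Lfun1_integrable.
by apply: ae_eq_Rintegral; apply: filterS ff' => x ->.
Qed.

Lemma Rintegral_aeB f g : Lae 1 f -> Lae 1 g ->
  \int[mu]_x (f x - g x) = \int[mu]_x f x - \int[mu]_x g x.
Proof.
move=> fL gL; rewrite -mulN1r -Rintegral_aeZ// -Rintegral_aeD//; last exact: LaeZ.
by apply: eq_Rintegral => x _; rewrite mulN1r.
Qed.

Lemma Rintegral_ae_sum I (s : seq I) (F : I -> T -> R) :
  (forall i, Lae 1 (F i)) ->
  \int[mu]_x (\sum_(i <- s) F i x) = \sum_(i <- s) \int[mu]_x F i x.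
Proof.
move=> FL; elim: s => [|i s IH].
  rewrite big_nil; under eq_Rintegral do rewrite big_nil.
  by rewrite Rintegral_cst// mul0r.
rewrite big_cons -IH -Rintegral_aeD//; last exact: Lae_sum.
by apply: eq_Rintegral => x _; rewrite big_cons.
Qed.

Lemma Rintegral_ae_ge0 f : {ae mu, forall x, 0 <= f x} -> 0 <= \int[mu]_x f x.
Proof.
move=> f0; rewrite (@ae_eq_Rintegral _ (fun x => `|f x|)).
  by apply: Rintegral_ge0.
by apply: filterS f0 => x /ger0_norm ->.
Qed.

Lemma le_Rintegral_ae f g : Lae 1 f -> Lae 1 g ->
  {ae mu, forall x, f x <= g x} -> \int[mu]_x f x <= \int[mu]_x g x.
Proof.
move=> fL gL fg; rewrite -subr_ge0 -Rintegral_aeB//; apply: Rintegral_ae_ge0.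
by apply: filterS fg => x; rewrite subr_ge0.
Qed.

End ae_integral.

(** * Density in L2 of an algebra of bounded functions *)

Section threshold.
Context {R : realType}.
Implicit Types y z : R.

Lemma bernoulli_ge z n : -1 <= z -> 1 + z *+ n <= (1 + z) ^+ n.
Proof.
move=> z1; elim: n => [|n IH]; first by rewrite mulr0n addr0 expr0.
have z0 : 0 <= 1 + z by lra.
rewrite exprS (le_trans _ (ler_wpM2l z0 IH))//.
rewrite -(mulr_natl z n) -(mulr_natl z n.+1) -natr1.
have -> : (1 + z) * (1 + n%:R * z) = 1 + (n%:R + 1) * z + n%:R * (z * z) by ring.
by rewrite lerDl mulr_ge0// -expr2 sqr_ge0.
Qed.

(** Bernoulli bounds 1 + n z by (1 + z)^n, and (1 - z)^n (1 + z)^n = (1 - z^2)^n is at most 1. *)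
Lemma exprB_le z n : 0 <= z <= 1 -> (1 - z) ^+ n <= (1 + z *+ n)^-1.
Proof.
move=> /andP[z0 z1].
have pz : 0 < 1 + z *+ n by rewrite ltr_pwDl// mulrn_wge0.
rewrite -[leRHS]mul1r ler_pdivlMr//.
rewrite (@le_trans _ _ ((1 - z) ^+ n * (1 + z) ^+ n))//.
  rewrite ler_wpM2l ?exprn_ge0 ?subr_ge0// bernoulli_ge//; lra.
rewrite -exprMn exprn_ile1//; nra.
Qed.

(* Converges on [0, 1] to the indicator of [y < 1/2], also at [y = 1/2]: the
   exponent is chosen so that (n 2^n) y^n = n (2 y)^n tends to 0 or to infinity. *)
Definition thr n y := (1 - y ^+ n) ^+ (n * 2 ^ n).

Lemma thr_bound n y : 0 <= y <= 1 -> 0 <= thr n y <= 1.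
Proof.
move=> /andP[y0 y1]; have yn0 : 0 <= y ^+ n by rewrite exprn_ge0.
have yn1 : y ^+ n <= 1 by rewrite exprn_ile1.
by rewrite /thr exprn_ge0 ?subr_ge0//= exprn_ile1 ?subr_ge0// gerBl.
Qed.

(** With s the square root of z, n z^n = (n s^n) s^n. The factor n s^n is at most 1 / (1 - s), by
    [exprB_le] at 1 - s, so a geometric sequence dominates. *)
Lemma cvg_natmul_geometric z : 0 <= z < 1 -> (z ^+ n *+ n) @[n --> \oo] --> (0 : R).
Proof.
move=> /andP[z0 z1]; set s := Num.sqrt z.
have s0 : 0 <= s by exact: sqrtr_ge0.
have s1 : s < 1 by rewrite -sqrtr1 ltr_sqrt.
have zE : z = s * s by rewrite -expr2 sqr_sqrtr.
apply: (@squeeze_cvgr _ _ _ _ (fun=> 0) (fun n => (1 - s)^-1 * s ^+ n)).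
- apply: nearW => n; rewrite mulrn_wge0 ?exprn_ge0//=.
  rewrite zE exprMn -mulr_natl mulrA ler_wpM2r ?exprn_ge0//.
  have d0 : 0 < 1 - s by lra.
  have := @exprB_le (1 - s) n; rewrite subKr => /(_ ltac:(lra)).
  have pz : 0 < 1 + (1 - s) *+ n by rewrite ltr_pwDl// mulrn_wge0// ltW.
  rewrite -[X in _ <= X -> _]mul1r ler_pdivlMr// => h.
  rewrite -[leRHS]mul1r ler_pdivlMr// (le_trans _ h)// -mulr_natl.
  have := exprn_ge0 n s0; nra.
- exact: cvg_cst.
- by apply: cvg_geometric; rewrite ger0_norm.
Qed.

(** For y < 1/2, Bernoulli gives thr n y >= 1 - n (2 y)^n. For y >= 1/2, [exprB_le] gives thr n y <=
    1 / (1 + n (2 y)^n) <= 1 / (n + 1). *)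
Lemma cvg_thr y : 0 <= y <= 1 -> thr n y @[n --> \oo] --> ((y < 2^-1)%R%:R : R).
Proof.
move=> y01; have /andP[y0 y1] := y01.
have pE n : y ^+ n *+ (n * 2 ^ n) = (2 * y) ^+ n *+ n.
  by rewrite mulnC mulrnA -[y ^+ n *+ _]mulr_natl natrX -exprMn.
have [yh|yh] := ltP y 2^-1.
  have c0 : (2 * y) ^+ n *+ n @[n --> \oo] --> (0 : R).
    by apply: cvg_natmul_geometric; lra.
  apply: (@squeeze_cvgr _ _ _ _ (fun n => 1 - (2 * y) ^+ n *+ n) (fun=> 1)).
  - near=> n; have /andP[_ ->] := thr_bound n y01; rewrite andbT.
    rewrite -pE -mulNrn bernoulli_ge// lerN2 exprn_ile1//.
  - rewrite -[X in _ --> X]subr0; apply: cvgB => //; exact: cvg_cst.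
  - exact: cvg_cst.
apply: (@squeeze_cvgr _ _ _ _ (fun=> 0) (fun n => n.+1%:R^-1)).
- near=> n; have /andP[-> _] := thr_bound n y01; rewrite /=.
  rewrite (le_trans (exprB_le _ _))// ?exprn_ge0 ?exprn_ile1//.
  rewrite pE lef_pV2 ?posrE//; last first.
    by rewrite ltr_pwDl// mulrn_wge0// exprn_ge0; lra.
  rewrite -natr1 addrC lerD2l -(mulr_natl ((2 * y) ^+ n) n) ler_peMr//.
  by rewrite exprn_ege1; lra.
- exact: cvg_cst.
- exact: cvg_harmonic.
Unshelve. all: by end_near. Qed.

End threshold.

Section density.
Context {disp : measure_display} {T : measurableType disp} {R : realType}.
Variable mu : probability T R.
Implicit Types f g h : T -> R.

Lemma LaeB f g : Lae mu 2%:E f -> Lae mu 2%:E g -> Lae mu 2%:E (fun x => f x - g x).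
Proof.
move=> fL gL; apply: Lae_eq (LaeD _ fL (LaeZ (-1) _ gL)); rewrite ?ler1n ?lee_fin ?ler1n//.
by apply: aeW => x; rewrite mulN1r.
Qed.

Lemma Lae_sqr f : Lae mu 2%:E f -> Lae mu 1 (fun x => f x ^+ 2).
Proof. by move=> fL; under eq_fun do rewrite expr2; exact: LaeM. Qed.

Lemma Lfun_Lae p f : f \in Lfun mu p -> Lae mu p f.
Proof. by move=> fL; exists f => //; exact: aeW. Qed.

Lemma bounded_Lae (M : R) f : measurable_fun setT f -> (forall x, `|f x| <= M) ->
  Lae mu 2%:E f.
Proof. by move=> mf fM; apply/Lfun_Lae/(Lfun_bounded _ mf fM). Qed.

(** Stands in for the triangle inequality of the L2 norm. Its two factors 2 are why tolerances are
    divided by 4 below. *)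
Lemma Rintegral_sqrD_le f g : Lae mu 2%:E f -> Lae mu 2%:E g ->
  \int[mu]_x (f x + g x) ^+ 2 <=
  2 * \int[mu]_x (f x) ^+ 2 + 2 * \int[mu]_x (g x) ^+ 2.
Proof.
move=> fL gL; have f2 := Lae_sqr fL; have g2 := Lae_sqr gL.
rewrite -!Rintegral_aeZ// -Rintegral_aeD; [|exact: LaeZ|exact: LaeZ].
apply: le_Rintegral_ae.
- by apply: Lae_sqr; apply: LaeD => //; rewrite lee_fin ler1n.
- by apply: LaeD => //; apply: LaeZ.
- by apply: aeW => x; have := sqr_ge0 (f x - g x); nra.
Qed.

Record bounded_algebra (Alg : set (T -> R)) : Prop := BoundedAlgebra {
  algebra_cst : forall c, Alg (cst c);
  algebraD : forall p q, Alg p -> Alg q -> Alg (fun x => p x + q x);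
  algebraM : forall p q, Alg p -> Alg q -> Alg (fun x => p x * q x);
  algebra_measurable : forall p, Alg p -> measurable_fun setT p;
  algebra_bounded : forall p, Alg p -> exists M : R, forall x, `|p x| <= M }.

Variable Alg : set (T -> R).

Definition L2closure f := forall eps : R, 0 < eps ->
  exists2 p, Alg p & \int[mu]_x (f x - p x) ^+ 2 < eps.

Hypothesis hAlg : bounded_algebra Alg.

Let Algc := algebra_cst hAlg.
Let AlgD := algebraD hAlg.
Let AlgM := algebraM hAlg.
Let Algm := algebra_measurable hAlg.
Let Algb := algebra_bounded hAlg.

Lemma Alg_Lae p : Alg p -> Lae mu 2%:E p.
Proof. by move=> Tp; have [M pM] := Algb Tp; exact: bounded_Lae (Algm Tp) pM. Qed.

Lemma L2closure_Alg p : Alg p -> L2closure p.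
Proof.
move=> Tp e e0; exists p => //.
under eq_Rintegral do rewrite subrr expr0n/=.
by rewrite Rintegral_cst// mul0r.
Qed.

Lemma L2closure_closed f : Lae mu 2%:E f ->
  (forall eps : R, 0 < eps -> exists h, [/\ Lae mu 2%:E h, L2closure h &
     \int[mu]_x (f x - h x) ^+ 2 < eps]) -> L2closure f.
Proof.
move=> fL fh e e0; have e4 : 0 < e / 4 by rewrite divr_gt0.
have [h [hL /(_ _ e4)[p Tp hp] fhe]] := fh _ e4; exists p => //.
have pL := Alg_Lae Tp.
have := Rintegral_sqrD_le (LaeB fL hL) (LaeB hL pL).
under eq_Rintegral do rewrite addrA subrK; move=> h1.
by apply: (le_lt_trans h1); lra.
Qed.

Lemma L2closureD f g : Lae mu 2%:E f -> Lae mu 2%:E g ->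
  L2closure f -> L2closure g -> L2closure (fun x => f x + g x).
Proof.
move=> fL gL cf cg e e0; have e4 : 0 < e / 4 by rewrite divr_gt0.
have [p Tp fp] := cf _ e4; have [q Tq gq] := cg _ e4.
exists (fun x => p x + q x); first exact: AlgD.
have := Rintegral_sqrD_le (LaeB fL (Alg_Lae Tp)) (LaeB gL (Alg_Lae Tq)).
under eq_Rintegral do rewrite addrACA -opprD.
by move=> h1; apply: (le_lt_trans h1); lra.
Qed.

Lemma Lae_bM (M : R) f g : measurable_fun setT f -> (forall x, `|f x| <= M) ->
  Lae mu 2%:E g -> Lae mu 2%:E (fun x => f x * g x).
Proof.
move=> mf fM gL; apply: LaeyM => //; apply: (bounded_Laey mf); first exact: aeW.
by apply: aeW => x; exact: fM.
Qed.

(** The constant is M^2 + 1 rather than M^2, so that a tolerance can be divided by it even when M =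
    0. *)
Lemma Rintegral_sqrM_le (M : R) f g : measurable_fun setT f ->
  (forall x, `|f x| <= M) -> Lae mu 2%:E g ->
  \int[mu]_x (f x * g x) ^+ 2 <= (M ^+ 2 + 1) * \int[mu]_x (g x) ^+ 2.
Proof.
move=> mf fM gL; rewrite -Rintegral_aeZ; last exact: Lae_sqr.
apply: le_Rintegral_ae.
- exact: Lae_sqr (Lae_bM mf fM gL).
- exact: LaeZ (Lae_sqr gL).
apply: aeW => x; rewrite exprMn ler_wpM2r ?sqr_ge0//.
rewrite (@le_trans _ _ (M ^+ 2)) ?lerDl// -[leLHS]real_normK ?num_real//.
by rewrite ler_pXn2r ?nnegrE// (le_trans _ (fM x)).
Qed.

Lemma L2closure_AlgM p f : Lae mu 2%:E f -> Alg p -> L2closure f ->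
  L2closure (fun x => p x * f x).
Proof.
move=> fL Tp cf e e0; have [M pM] := Algb Tp.
have M0 : 0 < M ^+ 2 + 1 by rewrite ltr_wpDl ?sqr_ge0.
have [|q Tq fq] := cf (e / (M ^+ 2 + 1)); first by rewrite divr_gt0.
exists (fun x => p x * q x); first exact: AlgM.
under eq_Rintegral do rewrite -mulrBr.
apply: le_lt_trans (Rintegral_sqrM_le (Algm Tp) pM (LaeB fL (Alg_Lae Tq))) _.
by rewrite -ltr_pdivlMl// mulrC.
Qed.

(** Approximation in two stages, as the approximants of [f] need not share its bound: [g] is
    replaced by some [q] in the algebra, at a cost controlled by the bound on [f], and then f q is a
    limit because [q] is a fixed bounded multiplier. *)
Lemma L2closureM (M : R) f g : measurable_fun setT f -> (forall x, `|f x| <= M) ->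
  Lae mu 2%:E g -> L2closure f -> L2closure g -> L2closure (fun x => f x * g x).
Proof.
move=> mf fM gL cf cg; apply: L2closure_closed; first exact: Lae_bM mf fM gL.
move=> e e0; have M0 : 0 < M ^+ 2 + 1 by rewrite ltr_wpDl ?sqr_ge0.
have fL := bounded_Lae mf fM.
have [|q Tq gq] := cg (e / (M ^+ 2 + 1)); first by rewrite divr_gt0.
exists (fun x => f x * q x); split.
- exact: Lae_bM mf fM (Alg_Lae Tq).
- by under eq_fun do rewrite mulrC; exact: L2closure_AlgM.
under eq_Rintegral do rewrite -mulrBr.
apply: le_lt_trans (Rintegral_sqrM_le mf fM (LaeB gL (Alg_Lae Tq))) _.
by rewrite -ltr_pdivlMl// mulrC.
Qed.

Lemma L2closure_cvg h (f_ : nat -> T -> R) f : h \in Lfun mu 2%:E ->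
  (forall n, measurable_fun setT (f_ n)) -> (forall n, L2closure (f_ n)) ->
  (forall n x, `|f_ n x| <= h x) -> (forall x, f_ n x @[n --> \oo] --> f x) ->
  L2closure f.
Proof.
move=> hL mf_ cf_ f_h f_f.
have mf : measurable_fun setT f by apply: (@measurable_fun_cvg _ _ _ setT f_) => // x _; exact: f_f.
have mh := Lfun_measurable hL.
have fh x : `|f x| <= h x.
  by apply: (ler_cvg_to (cvg_norm (f_f x)) (cvg_cst (h x))); exact: nearW.
have dom g : measurable_fun setT g -> (forall x, `|g x| <= h x) -> Lae mu 2%:E g.
  move=> mg gh; apply/Lfun_Lae/Lfun2P => //.
  apply: le_integrable (Lfun2_integrable_sqr hL) => //.
    by apply/measurable_EFinP; exact: measurable_funX.
  move=> x _ /=; rewrite lee_fin !ger0_norm ?sqr_ge0// -[leLHS]real_normK ?num_real//.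
  by rewrite ler_pXn2r ?nnegrE// (le_trans _ (gh x)).
apply: L2closure_closed; first exact: dom.
move=> e e0.
(* Both f and f_n are bounded by h in absolute value, hence (f - f_n)^2 <= 4 h^2, and 4 h^2 is
   integrable. *)
have [|||||_ + _] := @dominated_convergence _ _ _ mu setT measurableT
  (fun n x => ((f x - f_ n x) ^+ 2)%:E) (cst 0%E) (fun x => (4 * h x ^+ 2)%:E).
- move=> n; apply/measurable_EFinP; apply: measurable_funX; exact: measurable_funB.
- exact: measurable_cst.
- apply: aeW => x _; apply: cvg_EFin; first exact: nearW.
  have fx : (f x - f_ n x) @[n --> \oo] --> (0 : R).
    by rewrite -(subrr (f x)); apply: cvgB => //; exact: cvg_cst.
  by have := cvgM fx fx; rewrite mulr0; exact.
- exact: (integrableZl measurableT 4 (Lfun2_integrable_sqr hL)).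
- apply: aeW => x n _ /=; rewrite lee_fin ger0_norm ?sqr_ge0//.
  have := fh x; have := f_h n x; rewrite !ler_norml => /andP[? ?] /andP[? ?]; nra.
move=> /fine_cvgP[_ /cvgrPdist_lt/(_ _ e0)[n _ /(_ n (leqnn _))]] /=.
rewrite sub0r normrN => hn; exists (f_ n); split => //; first exact: dom.
apply: le_lt_trans hn; rewrite (le_trans _ (ler_norm _))// le_eqVlt; apply/orP; left.
apply/eqP; congr fine; apply: eq_integral => x _ /=.
by rewrite subr0 ger0_norm ?sqr_ge0.
Qed.

(* Compose [p] with the polynomials [thr n]. *)
Lemma L2closure_pos p : Alg p -> (forall x, `|p x| <= 1) ->
  L2closure \1_[set x | 0 < p x].
Proof.
(* The affine change y = (1 - p) / 2 sends [-1, 1] to [0, 1] and turns p > 0 into y < 1/2, the set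
   selected by [thr]. *)
move=> Tp p1; pose y x := 2^-1 + - 2^-1 * p x.
have AlgX q n : Alg q -> Alg (fun x => q x ^+ n).
  move=> Tq; elim: n => [|n IH].
    by rewrite (_ : (fun x => _) = cst 1)//; apply/funext => x; rewrite expr0.
  by under eq_fun do rewrite exprS; exact: AlgM.
have Ty : Alg y by apply: AlgD; [exact: Algc|apply: AlgM => //; exact: Algc].
have y01 x : 0 <= y x <= 1.
  by have := p1 x; rewrite ler_norml => /andP[? ?]; rewrite /y; lra.
have Tt n : Alg (fun x => thr n (y x)).
  rewrite /thr; apply: (AlgX); apply: AlgD; first exact: Algc.
  under eq_fun do rewrite -mulN1r; apply: AlgM; [exact: Algc|exact: AlgX].
apply: (@L2closure_cvg (cst 1) (fun n x => thr n (y x))).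
- exact: Lfun_cst.
- by move=> n; exact: Algm.
- by move=> n; exact: L2closure_Alg.
- by move=> n x; have /andP[h0 h1] := thr_bound n (y01 x); rewrite ger0_norm.
- move=> x; rewrite indicE (_ : (x \in _) = (y x < 2^-1)); first exact: cvg_thr.
  apply/idP/idP; rewrite inE /y /=; lra.
Qed.

Definition L2set (S : set T) := measurable S /\ L2closure \1_S.

Lemma indic_bound (S : set T) x : `|\1_S x : R| <= 1.
Proof. by rewrite indicE; case: (_ \in _); rewrite ?normr1 ?normr0. Qed.

Lemma indic_Lae (S : set T) : measurable S -> Lae mu 2%:E \1_S.
Proof. by move=> mS; apply: (@bounded_Lae 1) => // x; exact: indic_bound. Qed.

Lemma L2setC S : L2set S -> L2set (~` S).
Proof.
move=> [mS cS]; split; first exact: measurableC.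
rewrite (_ : \1__ = fun x => cst 1 x + (cst (-1) x * \1_S x)).
  apply: L2closureD.
  - exact: Lae_cst.
  - by apply: LaeZ; [rewrite ler1n|exact: indic_Lae].
  - exact/L2closure_Alg/Algc.
  - by apply: L2closure_AlgM => //; exact: indic_Lae.
by apply/funext => x; rewrite indicC /= indicE; case: (_ \in _) => /=; lra.
Qed.

Lemma L2setI S S' : L2set S -> L2set S' -> L2set (S `&` S').
Proof.
move=> [mS cS] [mS' cS']; split; first exact: measurableI.
rewrite indicI; apply: (@L2closureM 1) => //; first exact: indic_bound.
exact: indic_Lae.
Qed.

Lemma L2setU S S' : L2set S -> L2set S' -> L2set (S `|` S').
Proof. by move=> cS cS'; rewrite -[_ `|` _]setCK setCU; apply/L2setC/L2setI; exact: L2setC. Qed.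

Lemma L2set0 : L2set set0.
Proof.
split => //; rewrite (_ : \1__ = cst 0); first exact/L2closure_Alg/Algc.
by apply/funext => x; rewrite indic0.
Qed.

(** At each point the indicators of the finite partial unions are eventually constant, and all are
    bounded by 1, so [L2closure_cvg] applies. *)
Lemma L2set_bigcup (F : (set T)^nat) : (forall n, L2set (F n)) ->
  L2set (\bigcup_n F n).
Proof.
move=> cF; have cn n : L2set (\big[setU/set0]_(i < n) F i).
  elim/big_ind : _ => //; [exact: L2set0|exact: L2setU].
split; first by apply: bigcupT_measurable => n; have [] := cF n.
apply: (@L2closure_cvg (cst 1) (fun n => \1_(\big[setU/set0]_(i < n) F i))).
- exact: Lfun_cst.
- by move=> n; have [mS _] := cn n; exact: measurable_indic.
- by move=> n; have [] := cn n.
- by move=> n x; exact: indic_bound.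
- move=> x; rewrite indicE; apply: cvg_near_cst.
  have [xF|xF] := pselect ((\bigcup_n F n) x).
    have [m _ Fm] := xF; exists m.+1 => // n /= mn; rewrite indicE !mem_set//.
    by rewrite -bigcup_mkord; exists m.
  apply: nearW => n; rewrite indicE !memNset// -bigcup_mkord => -[m _ Fm].
  by apply: xF; exists m.
Qed.

Lemma L2set_sigma (G : set (set T)) : G `<=` L2set -> <<s G >> `<=` L2set.
Proof.
move=> GD; apply: smallest_sub => //; split.
- exact: L2set0.
- by move=> S cS; rewrite setTD; exact: L2setC.
- exact: L2set_bigcup.
Qed.

Hypothesis all_L2set : measurable `<=` L2set.

Import HBNNSimple.

Lemma L2closure_nnsfun (f : {nnsfun T >-> R}) : L2closure f.
Proof.
rewrite (_ : (f : T -> R) = fun x => \sum_(y <- finmap.enum_fset (fset_set (range f))) y * \1_(f @^-1` [set y]) x); last first.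
  by apply/funext => x; rewrite fimfunE fsbig_finite.
elim: (finmap.enum_fset _) => [|y s IH].
  by under eq_fun do rewrite big_nil; exact: (L2closure_Alg (Algc 0)).
have mi z : measurable (f @^-1` [set z]) by exact: measurable_sfunP.
have iL z : Lae mu 2%:E (fun x => z * \1_(f @^-1` [set z]) x).
  by apply: LaeZ; [rewrite ler1n|exact: indic_Lae].
under eq_fun do rewrite big_cons; apply: L2closureD => //.
- by apply: Lae_sum => //; rewrite ler1n.
- apply: (@L2closure_AlgM (cst y)) => //; first exact: indic_Lae.
  by have [] := all_L2set (mi y).
Qed.

Lemma L2closure_ge0 f : f \in Lfun mu 2%:E -> (forall x, 0 <= f x) -> L2closure f.
Proof.
move=> fL f0; have mf : measurable_fun setT (EFin \o f).
  by apply/measurable_EFinP; exact: Lfun_measurable fL.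
have f0' x : (0 <= (EFin \o f) x)%E by rewrite lee_fin.
apply: (@L2closure_cvg f (fun n => nnsfun_approx measurableT mf n)) => //.
- by move=> n; exact: L2closure_nnsfun.
- move=> n x; rewrite ger0_norm// -lee_fin nnsfun_approxE.
  exact: (@le_approx _ _ _ _ (EFin \o f)).
- by move=> x; have /fine_cvgP[] := cvg_nnsfun_approx measurableT mf (fun y _ => f0' y) (I : setT x).
Qed.

(** A Borel representative g is the difference of the nonnegative L2 functions |g| + g and |g|. *)
Lemma L2_dense f : Lae mu 2%:E f -> L2closure f.
Proof.
move=> [g gL fg] e e0.
have mg := Lfun_measurable gL.
have nL : (fun x => `|g x|) \in Lfun mu 2%:E.
  apply: Lfun2P; first exact: measurableT_comp.
  apply: eq_integrable (Lfun2_integrable_sqr gL) => // x _ /=.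
  by rewrite real_normK ?num_real.
have sL : (fun x => `|g x| + g x) \in Lfun mu 2%:E.
  by apply: (Lfun_addr_closed mu _).2; rewrite ?lee_fin ?ler1n.
have [||||p Tp gp] := @L2closureD (fun x => `|g x| + g x) (fun x => cst (-1) x * `|g x|) _ _ _ _ e e0.
- exact: Lfun_Lae.
- by apply: LaeZ; [rewrite ler1n|exact: Lfun_Lae].
- by apply: L2closure_ge0 => // x; have := ler_norm (- g x); rewrite normrN; lra.
- apply: L2closure_AlgM; [exact: Lfun_Lae|exact: Algc|exact: L2closure_ge0].
exists p => //; rewrite (@ae_eq_Rintegral _ _ _ _ _ (fun x => (`|g x| + g x + cst (-1) x * `|g x| - p x) ^+ 2))//.
by apply: filterS fg => x -> /=; congr (_ ^+ 2); lra.
Qed.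

End density.

(** * The cell measure *)

Section unit_interval_integrals.
Context {R : realType}.

Lemma ae_unit_itv : {ae @itv_measure R, forall x, x \in (@unit_itv R)}.
Proof.
exists (~` unit_itv); split => //=.
- by apply: measurableC; exact: measurable_unit_itv.
- by rewrite /itv_measure /mrestr setICl measure0.
- by move=> x /= h xD; apply: h; rewrite inE.
Qed.

(** The two endpoints are null; the closed interval is the form that the fundamental theorem of
    calculus takes. *)
Lemma Rintegral_itv_measure (f : R -> R) : continuous f ->
  \int[@itv_measure R]_x f x =
  \int[@lebesgue_measure R]_(x in `[- 2^-1, 2^-1]) f x.
Proof.
move=> cf; have mf : measurable_fun setT f by exact: continuous_measurable_fun.
rewrite /Rintegral integral_itv_bndoo; last by apply/measurable_EFinP/measurable_funTS.
rewrite -(@eq_measure_integral _ _ _ _ (@lebesgue_measure R) (@itv_measure R)); last first.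
  move=> A mA AD; rewrite /= /itv_measure /mrestr; congr (_ _).
  exact: setIidl.
rewrite [in RHS]integral_mkcond; congr fine; apply: ae_eq_integralW.
by apply: filterS ae_unit_itv => x xD; rewrite patchE xD.
Qed.

Lemma sin_intpi (k : int) : sin (k%:~R * pi) = 0 :> R.
Proof.
have sn (n : nat) : sin (n%:R * pi) = 0 :> R.
  elim: n => [|n IH]; first by rewrite mul0r sin0.
  by rewrite -natr1 mulrDl mul1r sinDpi IH oppr0.
case: k => n; first exact: sn.
by rewrite NegzE rmorphN /= mulNr sinN sn oppr0.
Qed.

Lemma continuous_cosM (c : R) : continuous (fun x : R => cos (c * x)).
Proof.
move=> x; apply: (@continuous_comp _ _ _ (fun x => c * x) cos).
  exact: mulrl_continuous.
exact: continuous_cos.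
Qed.

Lemma continuous_sinM (c : R) : continuous (fun x : R => sin (c * x)).
Proof.
move=> x; apply: (@continuous_comp _ _ _ (fun x => c * x) sin).
  exact: mulrl_continuous.
exact: continuous_sin.
Qed.

Lemma Rintegral_FTC2 (f F : R -> R) : continuous f ->
  (forall x : R, is_derive x 1 F (f x)) ->
  \int[@itv_measure R]_x f x = F 2^-1 - F (- 2^-1).
Proof.
move=> cf dF; rewrite Rintegral_itv_measure// /Rintegral.
have cF : continuous F.
  by move=> x; apply/differentiable_continuous/derivable1_diffP; have [] := dF x.
rewrite (@continuous_FTC2 _ f F)//.
- lra.
- exact: continuous_subspaceT.
- split; first by move=> x _; have [] := dF x.
  + by apply: cvg_at_right_filter; exact: cF.
  + by apply: cvg_at_left_filter; exact: cF.
- by move=> x _; rewrite derive1E; have [_ ->] := dF x.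
Qed.

Lemma Rintegral_cos_itv (k : int) :
  \int[@itv_measure R]_x cos (2 * pi * k%:~R * x) = (k == 0)%:R.
Proof.
have [->|k0] := eqVneq k 0.
  under eq_Rintegral do rewrite mulr0 mul0r cos0.
  by rewrite Rintegral_cst// mul1r; exact: (congr1 fine (@itv_measure_setT R)).
set c : R := 2 * pi * k%:~R.
have c0 : c != 0 by rewrite /c !mulf_neq0 ?intr_eq0// ?gt_eqF ?pi_gt0.
have dF (x : R) : is_derive x 1 (fun x : R => c^-1 * sin (c * x)) (cos (c * x)).
  by apply: is_derive_eq; rewrite /GRing.scale /=; field.
rewrite (Rintegral_FTC2 (@continuous_cosM c) dF).
rewrite mulrN sinN mulrN opprK (_ : c * 2^-1 = k%:~R * pi) ?sin_intpi ?mulr0 ?addr0//.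
by rewrite /c; lra.
Qed.

Lemma Rintegral_sin_itv (k : int) :
  \int[@itv_measure R]_x sin (2 * pi * k%:~R * x) = 0.
Proof.
have [->|k0] := eqVneq k 0.
  under eq_Rintegral do rewrite mulr0 mul0r sin0.
  by rewrite Rintegral_cst// mul0r.
set c : R := 2 * pi * k%:~R.
have c0 : c != 0 by rewrite /c !mulf_neq0 ?intr_eq0// ?gt_eqF ?pi_gt0.
have dF (x : R) : is_derive x 1 (fun x : R => - c^-1 * cos (c * x)) (sin (c * x)).
  by apply: is_derive_eq; rewrite /GRing.scale /=; field.
by rewrite (Rintegral_FTC2 (@continuous_sinM c) dF) mulrN cosN; lra.
Qed.

End unit_interval_integrals.

Section cell.
Context {R : realType}.

Lemma bounded_integrable d (T : measurableType d) (P : probability T R)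
    (M : R) (f : T -> R) : measurable_fun setT f -> (forall x, `|f x| <= M) ->
  P.-integrable setT (EFin \o f).
Proof.
move=> mf fM; apply: (@le_integrable _ _ _ _ _ measurableT _ (EFin \o cst M)).
- exact/measurable_EFinP.
- move=> x _ /=; rewrite lee_fin [leRHS]ger0_norm//.
  by rewrite (le_trans _ (fM x)).
- exact: finite_measure_integrable_cst.
Qed.

Lemma Rintegral_cell_cst n c : \int[cell_measure R n]_x c = c.
Proof.
rewrite Rintegral_cst// -[RHS]mulr1; congr (_ * _).
exact: (congr1 fine (@probability_setT _ _ _ (cell_measure R n))).
Qed.

Lemma Rintegral_cell_prod n (f : n.+1.-tuple R -> R) (u : R -> R)
    (v : n.-tuple R -> R) (Mu Mv : R) :
  measurable_fun setT f -> measurable_fun setT u -> measurable_fun setT v ->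
  (forall a, `|u a| <= Mu) -> (forall y, `|v y| <= Mv) ->
  (forall a y, f (tuple_cons (a, y)) = u a * v y) ->
  \int[cell_measure R n.+1]_x f x =
  \int[@itv_measure R]_a u a * \int[cell_measure R n]_y v y.
Proof.
move=> mf mu mv uM vM fE.
have iu := bounded_integrable (@itv_measure R) mu uM.
have iv := bounded_integrable (cell_measure R n) mv vM.
have mfc : measurable_fun setT (f \o @tuple_cons R n).
  by apply: measurableT_comp => //; exact: measurable_tuple_cons.
have ifc : (@itv_measure R \x cell_measure R n)%E.-integrable setT
    (EFin \o (f \o @tuple_cons R n)).
  apply: (@bounded_integrable _ _ _ (Mu * Mv)) => // -[a y] /=.
  by rewrite fE normrM ler_pM.
rewrite /Rintegral -fineM; [|exact: integrable_fin_num|exact: integrable_fin_num].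
congr fine; rewrite [LHS]integral_distribution//; last exact/measurable_EFinP.
rewrite -[LHS](integral12_prod_meas1 ifc).
transitivity (\int[@itv_measure R]_a ((u a)%:E * \int[cell_measure R n]_y (v y)%:E))%E.
  apply: eq_integral => a _; rewrite /fubini_F -integralZl//.
  by apply: eq_integral => y _ /=; rewrite fE EFinM.
have /fineK <- : (\int[cell_measure R n]_y (v y)%:E)%E \is a fin_num.
  exact: integrable_fin_num.
by rewrite integralZr.
Qed.

(** Source of [ae_cell]: the tuples with some coordinate outside the open interval form a finite
    union of null sets. *)
Lemma cell_coordinate n (a : 'I_n) (B : set R) : measurable B ->
  cell_measure R n ((fun x => tnth x a) @^-1` B) = @itv_measure R B.
Proof.
move=> mB; elim: n => [|n IH] in a *; first by case: a.
have cE S : cell_measure R n.+1 S =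
  (@itv_measure R \x cell_measure R n)%E (@tuple_cons R n @^-1` S) by [].
rewrite cE.
case: (unliftP ord0 a) => [b|] ->; last first.
  rewrite (_ : tuple_cons (n:=n) @^-1` _ = B `*` setT).
    by rewrite product_measure1E// -[RHS]mule1; congr (_ * _)%E; exact: probability_setT.
  by apply/seteqP; split => [[x y]|[x y] []] //=; rewrite tnth0.
rewrite (_ : tuple_cons (n:=n) @^-1` _ = setT `*` ((fun x => tnth x b) @^-1` B)).
  rewrite product_measure1E//.
    by rewrite -[RHS]mul1e; congr (_ * _)%E; [exact: itv_measure_setT|exact: IH].
  by rewrite -[X in measurable X]setTI; apply: measurable_tnth.
by apply/seteqP; split => [[x y]|[x y] []] //=; rewrite tnthS.
Qed.

Lemma ae_cell n : {ae cell_measure R n, forall x, forall a, - 2^-1 < tnth x a < 2^-1}.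
Proof.
apply: filter_forall => a.
exists (~` ((fun x => tnth x a) @^-1` @unit_itv R)); split.
- rewrite preimage_setC -[X in measurable X]setTI.
  by apply: measurable_tnth => //; apply: measurableC; exact: measurable_itv.
- rewrite preimage_setC cell_coordinate; last by apply: measurableC; exact: measurable_itv.
  by rewrite /itv_measure /mrestr setICl measure0.
- by move=> x /= h xD; apply: h; move: xD; rewrite /unit_itv /= in_itv.
Qed.

Lemma measurable_phase n (k : 'cV[int]_n) :
  measurable_fun setT (@phase R n k).
Proof.
apply: measurable_funM => //; apply: measurable_sum => a.
by apply: measurable_funM => //; exact: measurable_tnth.
Qed.

Definition cosk n (k : 'cV[int]_n) (x : n.-tuple R) : R := cos (phase k x).
Definition sink n (k : 'cV[int]_n) (x : n.-tuple R) : R := sin (phase k x).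

Lemma measurable_cosk n (k : 'cV[int]_n) : measurable_fun setT (cosk k).
Proof.
apply: measurableT_comp; last exact: measurable_phase.
by apply: continuous_measurable_fun; exact: continuous_cos.
Qed.

Lemma measurable_sink n (k : 'cV[int]_n) : measurable_fun setT (sink k).
Proof.
apply: measurableT_comp; last exact: measurable_phase.
by apply: continuous_measurable_fun; exact: continuous_sin.
Qed.

Lemma phase_cons n (k : 'cV[int]_n.+1) a (y : n.-tuple R) :
  phase k (tuple_cons (a, y)) =
  2 * pi * (k ord0 0)%:~R * a + phase (\col_i k (lift ord0 i) 0) y.
Proof.
rewrite /phase big_ord_recl tnth0 mulrDr mulrA; congr (_ + _ * _).
by apply: eq_bigr => i _; rewrite tnthS mxE.
Qed.

(** The addition formulas split off the first coordinate and mix cosine with sine, so both integrals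
    go through one induction on the dimension. Each resulting product is integrated by Fubini. *)
Lemma Rintegral_cos_sin n (k : 'cV[int]_n) :
  \int[cell_measure R n]_x cosk k x = (k == 0)%:R /\
  \int[cell_measure R n]_x sink k x = 0.
Proof.
elim: n k => [|n IH] k.
  have ph0 x : @phase R 0 k x = 0 by rewrite /phase big_ord0 mulr0.
  have -> : k == 0 by apply/eqP/matrixP => -[].
  split.
    under eq_Rintegral do rewrite /cosk ph0 cos0.
    exact: Rintegral_cell_cst.
  under eq_Rintegral do rewrite /sink ph0 sin0.
  by rewrite Rintegral_cst// mul0r.
set k' := \col_i k (lift ord0 i) 0; have [IHc IHs] := IH k'.
pose c (a : R) := cos (2 * pi * (k ord0 0)%:~R * a).
pose s (a : R) := sin (2 * pi * (k ord0 0)%:~R * a).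
have mc : measurable_fun setT c by apply: continuous_measurable_fun; exact: continuous_cosM.
have ms : measurable_fun setT s by apply: continuous_measurable_fun; exact: continuous_sinM.
have c1 a : `|c a| <= 1 by exact: cos_max.
have s1 a : `|s a| <= 1 by exact: sin_max.
have C1 y : `|cosk k' y| <= 1 by exact: cos_max.
have S1 y : `|sink k' y| <= 1 by exact: sin_max.
have mC := measurable_cosk k'; have mS := measurable_sink k'.
have Ic : \int[@itv_measure R]_a c a = (k ord0 0 == 0)%:R by exact: Rintegral_cos_itv.
have Is : \int[@itv_measure R]_a s a = 0 by exact: Rintegral_sin_itv.
have fst_cons a y : thead (@tuple_cons R n (a, y)) = a by rewrite /thead tnth0.
have snd_cons a y : [tuple of behead (@tuple_cons R n (a, y))] = y by exact/val_inj.
have mh : measurable_fun setT (@thead n R) by exact: measurable_tnth.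
have mt : measurable_fun setT (fun x : n.+1.-tuple R => [tuple of behead x]).
  exact: measurable_behead.
have P (u : R -> R) (v : n.-tuple R -> R) : measurable_fun setT u -> measurable_fun setT v ->
    (forall a, `|u a| <= 1) -> (forall y, `|v y| <= 1) ->
  [/\ (cell_measure R n.+1).-integrable setT (EFin \o (fun x => u (thead x) * v [tuple of behead x])) &
   \int[cell_measure R n.+1]_x (u (thead x) * v [tuple of behead x]) =
   \int[@itv_measure R]_a u a * \int[cell_measure R n]_y v y].
  move=> mu mv u1 v1.
  have m : measurable_fun setT (fun x => u (thead x) * v [tuple of behead x]).
    by apply: measurable_funM; [apply: measurableT_comp mu mh|apply: measurableT_comp mv mt].
  split.
    apply: (@bounded_integrable _ _ _ 1 _ m) => x.
    by rewrite normrM mulr_ile1.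
  by apply: (@Rintegral_cell_prod _ _ _ _ 1 1) => // a y; rewrite fst_cons snd_cons.
have eta (x : n.+1.-tuple R) : x = tuple_cons (thead x, [tuple of behead x]).
  by apply/val_inj; rewrite {1}[x]tuple_eta.
have [i1 e1] := P c (cosk k') mc mC c1 C1.
have [i2 e2] := P s (sink k') ms mS s1 S1.
have [i3 e3] := P s (cosk k') ms mC s1 C1.
have [i4 e4] := P c (sink k') mc mS c1 S1.
have kE : (k == 0) = (k ord0 0 == 0) && (k' == 0).
  apply/eqP/andP => [kz|[/eqP k0 /eqP k'0]].
    split; first by rewrite kz mxE eqxx.
    by apply/eqP/matrixP => i j; rewrite /k' kz !mxE.
  apply/matrixP => i j; rewrite ord1 mxE; case: (unliftP ord0 i) => [b|] -> //.
  by have /matrixP/(_ b 0) := k'0; rewrite !mxE.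
split.
  transitivity (\int[cell_measure R n.+1]_x (c (thead x) * cosk k' [tuple of behead x]
     - s (thead x) * sink k' [tuple of behead x])).
    by apply: eq_Rintegral => x _; rewrite {1}[x]eta /cosk phase_cons cosD.
  rewrite RintegralB// e1 e2 Ic Is IHc mul0r subr0 kE.
  by case: (k ord0 0 == 0); rewrite ?mul1r ?mul0r.
transitivity (\int[cell_measure R n.+1]_x (s (thead x) * cosk k' [tuple of behead x]
   + c (thead x) * sink k' [tuple of behead x])).
  by apply: eq_Rintegral => x _; rewrite {1}[x]eta /sink phase_cons sinD.
by rewrite RintegralD// e3 e4 Is IHs mul0r mulr0 addr0.
Qed.

End cell.

(** * Trigonometric polynomials *)

Section trigonometric_density.
Context {R : realType} {n : nat}.
Local Notation point := (n.-tuple R).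
Local Notation index := 'cV[int]_n.
Local Notation mu := (cell_measure R n).
Implicit Types (k l : index) (x : point) (f g p q : point -> R).

Lemma phaseD k l x : phase (k + l) x = phase k x + phase l x.
Proof.
rewrite /phase -mulrDr -big_split; congr (_ * _).
by apply: eq_bigr => a _; rewrite mxE rmorphD /= mulrDl.
Qed.

Lemma phaseN k x : phase (- k) x = - phase k x.
Proof.
rewrite /phase -mulrN -sumrN; congr (_ * _).
by apply: eq_bigr => a _; rewrite mxE rmorphN /= mulNr.
Qed.

Lemma phase0 x : phase 0 x = 0.
Proof.
by rewrite /phase big1 ?mulr0// => a _; rewrite mxE mul0r.
Qed.

Lemma phase_delta a x : phase (delta_mx a 0) x = 2 * pi * tnth x a.
Proof.
rewrite /phase (bigD1 a)//= mxE !eqxx mul1r big1 ?addr0// => b ba.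
by rewrite mxE (negbTE ba) mul0r.
Qed.

Lemma cosk0 x : cosk 0 x = 1. Proof. by rewrite /cosk phase0 cos0. Qed.
Lemma coskN k x : cosk (- k) x = cosk k x. Proof. by rewrite /cosk phaseN cosN. Qed.
Lemma sinkN k x : sink (- k) x = - sink k x. Proof. by rewrite /sink phaseN sinN. Qed.

Lemma cosk_cosk k l x :
  cosk k x * cosk l x = 2^-1 * cosk (k + l) x + 2^-1 * cosk (k - l) x.
Proof. by rewrite /cosk !phaseD phaseN cosD cosB; field. Qed.

Lemma sink_sink k l x :
  sink k x * sink l x = - 2^-1 * cosk (k + l) x + 2^-1 * cosk (k - l) x.
Proof. by rewrite /cosk /sink !phaseD phaseN cosD cosB; field. Qed.

Lemma sink_cosk k l x :
  sink k x * cosk l x = 2^-1 * sink (k + l) x + 2^-1 * sink (k - l) x.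
Proof. by rewrite /cosk /sink !phaseD phaseN sinD sinB; field. Qed.

(** Real cosines and sines keep all integrals real. The inductive form lets closure under products
    and orthogonality to Fourier remainders be proved by induction on the polynomial. *)
Inductive trigpoly : (point -> R) -> Prop :=
| trigpoly_cos a k : trigpoly (fun x => a * cosk k x)
| trigpoly_sin a k : trigpoly (fun x => a * sink k x)
| trigpolyD p q : trigpoly p -> trigpoly q -> trigpoly (fun x => p x + q x).

Lemma trigpoly_cst c : trigpoly (cst c).
Proof.
rewrite (_ : cst c = fun x => c * cosk 0 x); first exact: trigpoly_cos.
by apply/funext => x; rewrite cosk0 mulr1.
Qed.

Lemma trigpolyM p q : trigpoly p -> trigpoly q -> trigpoly (fun x => p x * q x).
Proof.
move=> Tp; elim: Tp q => [a k|a k|p1 p2 _ IH1 _ IH2] q; last first.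
- move=> Tq; under eq_fun do rewrite mulrDl.
  by apply: trigpolyD; [exact: IH1|exact: IH2].
- elim=> [b l|b l|q1 q2 _ IH1 _ IH2]; last first.
  + by under eq_fun do rewrite mulrDr; exact: trigpolyD.
  + under eq_fun do rewrite mulrACA sink_sink mulrDr !mulrA.
    by apply: trigpolyD; exact: trigpoly_cos.
  + under eq_fun do rewrite mulrACA sink_cosk mulrDr !mulrA.
    by apply: trigpolyD; exact: trigpoly_sin.
- elim=> [b l|b l|q1 q2 _ IH1 _ IH2]; last first.
  + by under eq_fun do rewrite mulrDr; exact: trigpolyD.
  + under eq_fun do rewrite mulrACA (mulrC (cosk _ _)) sink_cosk mulrDr !mulrA.
    by apply: trigpolyD; exact: trigpoly_sin.
  + under eq_fun do rewrite mulrACA cosk_cosk mulrDr !mulrA.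
    by apply: trigpolyD; exact: trigpoly_cos.
Qed.

Lemma trigpoly_measurable p : trigpoly p -> measurable_fun setT p.
Proof.
elim=> [a k|a k|p1 p2 _ IH1 _ IH2].
- by apply: measurable_funM => //; exact: measurable_cosk.
- by apply: measurable_funM => //; exact: measurable_sink.
- exact: measurable_funD.
Qed.

Lemma trigpoly_bounded p : trigpoly p -> exists M : R, forall x, `|p x| <= M.
Proof.
elim=> [a k|a k|p1 p2 _ [M1 h1] _ [M2 h2]].
- by exists `|a| => x; rewrite normrM ler_piMr// cos_max.
- by exists `|a| => x; rewrite normrM ler_piMr// sin_max.
- by exists (M1 + M2) => x; rewrite (le_trans (ler_normD _ _))// lerD.
Qed.

Lemma trigpoly_algebra : bounded_algebra trigpoly.
Proof.
split; [exact: trigpoly_cst|exact: trigpolyD|exact: trigpolyM|..].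
  exact: trigpoly_measurable.
exact: trigpoly_bounded.
Qed.

(* The left-hand side is cos (pi t) sin (pi (t - c)), which has period 1 in [t]. *)
Lemma half_space_test (c t : R) : - 2^-1 < c < 2^-1 -> - 2^-1 < t < 2^-1 ->
  (0 < 2^-1 * (cos (pi * c) * sin (2 * pi * t) - sin (pi * c) * cos (2 * pi * t)
      - sin (pi * c))) = (c < t).
Proof.
move=> /andP[c0 c1] /andP[t0 t1].
have pi0 := @pi_gt0 R.
rewrite (_ : 2^-1 * _ = cos (pi * t) * sin (pi * (t - c))); last first.
  rewrite (_ : 2 * pi * t = pi * t + pi * t); last by ring.
  rewrite (mulrBr pi t c) sinB cosD sinD; have := cos2Dsin2 (pi * t).
  move: (cos (pi * t)) (sin (pi * t)) (cos (pi * c)) (sin (pi * c)) => C S c' s' h.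
  have -> : s' * (C * C - S * S) = s' * (C ^+ 2 - (1 - C ^+ 2)) by rewrite -h; ring.
  by field.
(* The cosine is positive since |t| < 1/2, and sin (pi (t - c)) has the sign of t - c since |t - c|
   < 1. *)
have ct : 0 < cos (pi * t) by apply: cos_gt0_pihalf; apply/andP; split; nra.
rewrite pmulr_rgt0//; have [tc|tc] := ltP c t.
  by apply: sin_gt0_pi; apply/andP; split; nra.
apply/negbTE; rewrite -leNgt -oppr_ge0 -sinN; apply: sin_ge0_pi.
by apply/andP; split; nra.
Qed.

Lemma L2closure_ae f g : {ae mu, forall x, f x = g x} ->
  L2closure mu trigpoly g -> L2closure mu trigpoly f.
Proof.
move=> fg cg e e0; have [p Tp gp] := cg _ e0; exists p => //.
rewrite (@ae_eq_Rintegral _ _ _ _ _ (fun x => (g x - p x) ^+ 2))//.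
by apply: filterS fg => x ->.
Qed.

Local Notation L2set := (L2set mu trigpoly).

Lemma measurable_half_space a (c : R) : measurable [set x : point | c < tnth x a].
Proof.
rewrite (_ : [set _ | _] = setT `&` (fun x : point => tnth x a) @^-1` `]c, +oo[%classic).
  by apply: measurable_tnth => //; exact: measurable_itv.
by apply/seteqP; split => x /=; rewrite in_itv/= andbT; [|case].
Qed.

Lemma L2set_half_space a (c : R) : L2set [set x | c < tnth x a].
Proof.
split; first exact: measurable_half_space.
have aeS := @ae_cell R n.
(* If c is not strictly between -1/2 and 1/2, the half space contains almost all of the cell or
   almost none of it, and its indicator is a.e. constant. *)
have [c0|c0] := leP c (- 2^-1).
  apply: (@L2closure_ae _ (cst 1)); last exact: (L2closure_Alg _ (trigpoly_cst 1)).
  have := aeS; apply: filterS => x /(_ a) /andP[h _].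
  by rewrite indicE mem_set//=; lra.
have [c1|c1] := leP 2^-1 c.
  apply: (@L2closure_ae _ (cst 0)); last exact: (L2closure_Alg _ (trigpoly_cst 0)).
  have := aeS; apply: filterS => x /(_ a) /andP[_ h].
  by rewrite indicE memNset//=; lra.
pose p x := 2^-1 * (cos (pi * c) * sin (2 * pi * tnth x a)
   - sin (pi * c) * cos (2 * pi * tnth x a) - sin (pi * c)).
apply: (@L2closure_ae _ \1_[set x | 0 < p x]).
  have := aeS; apply: filterS => x /(_ a) h.
  rewrite !indicE; congr (_%:R); congr nat_of_bool.
  by apply/idP/idP; rewrite !inE /= /p half_space_test// c0 c1.
apply: (L2closure_pos _ trigpoly_algebra).
- rewrite (_ : p = fun x => (2^-1 * cos (pi * c)) * sink (delta_mx a 0) x +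
    ((- 2^-1 * sin (pi * c)) * cosk (delta_mx a 0) x + cst (- 2^-1 * sin (pi * c)) x)).
    apply: trigpolyD; first exact: trigpoly_sin.
    by apply: trigpolyD; [exact: trigpoly_cos|exact: trigpoly_cst].
  by apply/funext => x; rewrite /p /cosk /sink phase_delta /=; ring.
(* By the subtraction formula p = (sin (2 pi t - pi c) - sin (pi c)) / 2, with t the coordinate of
   index a, hence |p| <= 1. *)
- move=> x; rewrite /p.
  have := sin_max (2 * pi * tnth x a - pi * c); have := sin_max (pi * c).
  rewrite !sinB !ler_norml => /andP[? ?] /andP[? ?].
  by apply/andP; split; lra.
Qed.

End trigonometric_density.

(** * Fourier partial sums, best approximation and Parseval orthogonality *)

Section fourier_projection.
Context {R : realType} {n : nat}.
Local Notation point := (n.-tuple R).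
Local Notation index := 'cV[int]_n.
Local Notation mu := (cell_measure R n).
Local Notation L2set := (L2set mu trigpoly).
Implicit Types (k l : index) (x : point) (f g p q : point -> R).

(** The sets [B] with this property form a sigma-algebra, and the rays ]c, +oo[, whose preimages are
    half spaces, generate the Borel sets. *)
Lemma L2set_coordinate a (B : set R) : measurable B ->
  L2set ((fun x => tnth x a) @^-1` B).
Proof.
move=> mB; have {mB} : <<s @RGenOInfty.G R >> B.
  have h := @RGenOInfty.measurableE R.
  by have : (measurable : set (set (g_sigma_algebraType (@ocitv R)))) B := mB; rewrite h.
move: B; apply: smallest_sub; last first.
  move=> _ [c ->]; rewrite (_ : _ @^-1` _ = [set x | c < tnth x a]).
    exact: L2set_half_space.
  by apply/seteqP; split => x /=; rewrite in_itv/= andbT.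
split.
- by rewrite preimage_set0; apply: (L2set0 _ trigpoly_algebra).
- by move=> B cB; rewrite setTD -preimage_setC; apply: (L2setC trigpoly_algebra).
- by move=> F cF; rewrite preimage_bigcup; apply: (L2set_bigcup trigpoly_algebra).
Qed.

Lemma measurable_L2set : measurable `<=` L2set.
Proof.
pose G := \big[setU/set0]_(i < n)
  preimage_set_system setT (fun x : point => tnth x i) measurable.
(* The sigma-algebra on tuples is by definition the one generated by the coordinate preimages
   collected in [G]. *)
suff h : <<s G >> `<=` L2set by exact: h.
apply: (L2set_sigma trigpoly_algebra).
move=> S; rewrite /G -bigcup_seq => -[i _ [B mB <-]].
by rewrite setTI; exact: L2set_coordinate.
Qed.

Lemma trigpoly_dense f (eps : R) : Lae mu 2%:E f -> 0 < eps ->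
  exists2 p, trigpoly p & \int[mu]_x (f x - p x) ^+ 2 < eps.
Proof.
move=> fL e0; exact: (L2_dense trigpoly_algebra measurable_L2set fL).
Qed.

Lemma cosk_Lae k : Lae mu 2%:E (cosk k).
Proof. by apply: (@bounded_Lae _ _ _ _ 1); [exact: measurable_cosk|move=> x; exact: cos_max]. Qed.

Lemma sink_Lae k : Lae mu 2%:E (sink k).
Proof. by apply: (@bounded_Lae _ _ _ _ 1); [exact: measurable_sink|move=> x; exact: sin_max]. Qed.

Lemma cosk_Lae1 k : Lae mu 1 (cosk k).
Proof.
have h := LaeM (cosk_Lae k) (cosk_Lae 0).
by apply: Lae_eq h; apply: aeW => x; rewrite cosk0 mulr1.
Qed.

Lemma sink_Lae1 k : Lae mu 1 (sink k).
Proof.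
have h := LaeM (sink_Lae k) (cosk_Lae 0).
by apply: Lae_eq h; apply: aeW => x; rewrite cosk0 mulr1.
Qed.

Lemma trigpoly_Lae p : trigpoly p -> Lae mu 2%:E p.
Proof.
move=> Tp; have [M pM] := trigpoly_bounded Tp.
exact: bounded_Lae (trigpoly_measurable Tp) pM.
Qed.

Lemma Rintegral_cosk k : \int[mu]_x cosk k x = (k == 0)%:R.
Proof. by have [] := @Rintegral_cos_sin R n k. Qed.

Lemma Rintegral_sink k : \int[mu]_x sink k x = 0.
Proof. by have [] := @Rintegral_cos_sin R n k. Qed.

Lemma Rintegral_cosk_cosk k l :
  \int[mu]_x (cosk k x * cosk l x) = 2^-1 * (k == - l)%:R + 2^-1 * (k == l)%:R.
Proof.
under eq_Rintegral do rewrite cosk_cosk.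
rewrite Rintegral_aeD ?Rintegral_aeZ ?Rintegral_cosk ?addr_eq0 ?opprK//;
  by [exact: cosk_Lae1|apply: LaeZ => //; exact: cosk_Lae1].
Qed.

Lemma Rintegral_sink_sink k l :
  \int[mu]_x (sink k x * sink l x) = - 2^-1 * (k == - l)%:R + 2^-1 * (k == l)%:R.
Proof.
under eq_Rintegral do rewrite sink_sink.
rewrite Rintegral_aeD ?Rintegral_aeZ ?Rintegral_cosk ?addr_eq0 ?opprK//;
  by [exact: cosk_Lae1|apply: LaeZ => //; exact: cosk_Lae1].
Qed.

Lemma Rintegral_sink_cosk k l : \int[mu]_x (sink k x * cosk l x) = 0.
Proof.
under eq_Rintegral do rewrite sink_cosk.
rewrite Rintegral_aeD ?Rintegral_aeZ ?Rintegral_sink ?mulr0 ?addr0//;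
  by [exact: sink_Lae1|apply: LaeZ => //; exact: sink_Lae1].
Qed.

Definition Ccoef f k := \int[mu]_x (f x * cosk k x).
Definition Scoef f k := \int[mu]_x (f x * sink k x).

(** The orthogonal projection onto the modes of K when K is duplicate-free and stable under
    negation: the equal terms at k and -k together supply the factor 2 that compensates the mean 1/2
    of cos^2 and sin^2, while k = 0 occurs once and needs no factor. *)
Definition partial_sum (K : seq index) f x :=
  \sum_(k <- K) (Ccoef f k * cosk k x + Scoef f k * sink k x).

Definition symmetric_seq (K : seq index) := uniq K /\ {in K, forall k, - k \in K}.

Lemma lee12 : (1 <= 2%:E :> \bar R)%E. Proof. by rewrite lee_fin ler1n. Qed.
Hint Resolve lee12 : core.
Lemma ler12 : 1 <= 2 :> R. Proof. by rewrite ler1n. Qed.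
Hint Resolve ler12 : core.

Lemma partial_sum_Lae K f : Lae mu 2%:E (partial_sum K f).
Proof.
apply: Lae_sum => // k; apply: LaeD => //; apply: LaeZ => //.
  exact: cosk_Lae.
exact: sink_Lae.
Qed.

Lemma Rintegral_partial_sum K f g : Lae mu 2%:E g ->
  \int[mu]_x (partial_sum K f x * g x) =
  \sum_(k <- K) (Ccoef f k * Ccoef g k + Scoef f k * Scoef g k).
Proof.
move=> gL; have gc k : Lae mu 1 (fun x => g x * cosk k x) by exact: LaeM (cosk_Lae k).
have gs k : Lae mu 1 (fun x => g x * sink k x) by exact: LaeM (sink_Lae k).
transitivity (\int[mu]_x \sum_(k <- K) (Ccoef f k * (g x * cosk k x) + Scoef f k * (g x * sink k x))).
  apply: eq_Rintegral => x _; rewrite mulr_suml; apply: eq_bigr => k _; ring.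
rewrite Rintegral_ae_sum; last by move=> k; apply: LaeD => //; exact: LaeZ.
apply: eq_bigr => k _; rewrite Rintegral_aeD; [|exact: LaeZ|exact: LaeZ].
by rewrite !Rintegral_aeZ.
Qed.

Lemma CcoefN f k : Ccoef f (- k) = Ccoef f k.
Proof. by apply: eq_Rintegral => x _; rewrite coskN. Qed.

Lemma ScoefN f k : Lae mu 2%:E f -> Scoef f (- k) = - Scoef f k.
Proof.
move=> fL; rewrite -mulN1r -Rintegral_aeZ; last exact: LaeM (sink_Lae k).
by apply: eq_Rintegral => x _; rewrite sinkN; ring.
Qed.

Lemma sum_delta (K : seq index) (F : index -> R) l : uniq K -> l \in K ->
  \sum_(k <- K) F k * (k == l)%:R = F l.
Proof.
move=> uK lK; rewrite (bigD1_seq l)//= eqxx mulr1 big1 ?addr0// => k /negbTE ->.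
by rewrite mulr0.
Qed.

(** Only the indices l and -l contribute, each with half of the coefficient; for l = 0 the two
    halves fall on the same index. *)
Lemma partial_sum_cos K f l : Lae mu 2%:E f -> symmetric_seq K -> l \in K ->
  \int[mu]_x (partial_sum K f x * cosk l x) = Ccoef f l.
Proof.
move=> fL [uK sK] lK; rewrite Rintegral_partial_sum; last exact: cosk_Lae.
transitivity (\sum_(k <- K) (2^-1 * Ccoef f k * (k == - l)%:R + 2^-1 * Ccoef f k * (k == l)%:R)).
  apply: eq_bigr => k _; rewrite /Ccoef /Scoef.
  under [X in _ * X + _]eq_Rintegral do rewrite mulrC.
  under [X in _ + _ * X]eq_Rintegral do rewrite mulrC.
  by rewrite Rintegral_cosk_cosk Rintegral_sink_cosk; ring.
rewrite big_split /= !sum_delta ?sK// CcoefN; by field.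
Qed.

Lemma partial_sum_sin K f l : Lae mu 2%:E f -> symmetric_seq K -> l \in K ->
  \int[mu]_x (partial_sum K f x * sink l x) = Scoef f l.
Proof.
move=> fL [uK sK] lK; rewrite Rintegral_partial_sum; last exact: sink_Lae.
transitivity (\sum_(k <- K) (- 2^-1 * Scoef f k * (k == - l)%:R + 2^-1 * Scoef f k * (k == l)%:R)).
  apply: eq_bigr => k _; rewrite /Ccoef /Scoef.
  under [X in _ + _ * X]eq_Rintegral do rewrite mulrC.
  by rewrite Rintegral_sink_sink Rintegral_sink_cosk; ring.
rewrite big_split /= !sum_delta ?sK// ScoefN//; by field.
Qed.

Lemma partial_sum_orth K f : Lae mu 2%:E f -> symmetric_seq K ->
  forall a b k, k \in K ->
  \int[mu]_x ((f x - partial_sum K f x) * (a * cosk k x + b * sink k x)) = 0.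
Proof.
move=> fL sK a b k kK.
have rL : Lae mu 2%:E (fun x => f x - partial_sum K f x).
  exact: LaeB (partial_sum_Lae K f).
have rc := LaeM rL (cosk_Lae k); have rs := LaeM rL (sink_Lae k).
transitivity (\int[mu]_x (a * ((f x - partial_sum K f x) * cosk k x) +
   b * ((f x - partial_sum K f x) * sink k x))).
  by apply: eq_Rintegral => x _; ring.
rewrite Rintegral_aeD; [|exact: LaeZ|exact: LaeZ].
rewrite !Rintegral_aeZ//.
under eq_Rintegral do rewrite mulrBl.
under [X in _ + _ * X]eq_Rintegral do rewrite mulrBl.
have pL := partial_sum_Lae K f.
have fc := LaeM fL (cosk_Lae k); have fs := LaeM fL (sink_Lae k).
have pc := LaeM pL (cosk_Lae k); have ps := LaeM pL (sink_Lae k).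
by rewrite !Rintegral_aeB// partial_sum_cos// partial_sum_sin// !subrr !mulr0 addr0.
Qed.

(** [K0] collects the frequencies of [p]; the remainder is orthogonal to every mode in K, hence to
    [p] as soon as K contains them. *)
Lemma Rintegral_sub_partial_sum_trig p : trigpoly p -> exists K0 : seq index,
  forall K f, Lae mu 2%:E f -> symmetric_seq K -> {subset K0 <= K} ->
  \int[mu]_x ((f x - partial_sum K f x) * p x) = 0.
Proof.
elim=> [a k|a k|p1 p2 T1 [K1 h1] T2 [K2 h2]].
- exists [:: k] => K f fL sK kK.
  rewrite -(@partial_sum_orth K f fL sK a 0 k) ?kK ?mem_head//.
  by apply: eq_Rintegral => x _; rewrite mul0r addr0.
- exists [:: k] => K f fL sK kK.
  rewrite -(@partial_sum_orth K f fL sK 0 a k) ?kK ?mem_head//.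
  by apply: eq_Rintegral => x _; rewrite mul0r add0r.
- exists (K1 ++ K2) => K f fL sK kK.
  have rL : Lae mu 2%:E (fun x => f x - partial_sum K f x).
    exact: LaeB (partial_sum_Lae K f).
  under eq_Rintegral do rewrite mulrDr.
  rewrite Rintegral_aeD; [|exact: LaeM (trigpoly_Lae T1)|exact: LaeM (trigpoly_Lae T2)].
  rewrite h1 ?h2 ?addr0// => k kK'; apply: kK; rewrite mem_cat kK' ?orbT//.
Qed.

Lemma Rintegral_sub_partial_sum_self K f : Lae mu 2%:E f -> symmetric_seq K ->
  \int[mu]_x ((f x - partial_sum K f x) * partial_sum K f x) = 0.
Proof.
move=> fL sK; have rL : Lae mu 2%:E (fun x => f x - partial_sum K f x).
  exact: LaeB (partial_sum_Lae K f).
under eq_Rintegral do rewrite mulrC.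
rewrite Rintegral_partial_sum// big_seq big1// => k kK.
have -> : Ccoef (fun x => f x - partial_sum K f x) k = 0.
  rewrite -(@partial_sum_orth K f fL sK 1 0 k kK).
  by apply: eq_Rintegral => x _; rewrite mul1r mul0r addr0.
have -> : Scoef (fun x => f x - partial_sum K f x) k = 0.
  rewrite -(@partial_sum_orth K f fL sK 0 1 k kK).
  by apply: eq_Rintegral => x _; rewrite mul1r mul0r add0r.
by rewrite !mulr0 addr0.
Qed.

(** Pythagoras: the remainder f - P is orthogonal to both P and p, so the squared distance from f to
    p is that from f to P plus that from P to p. *)
Lemma partial_sum_best_approx p : trigpoly p -> exists K0 : seq index,
  forall K f, Lae mu 2%:E f -> symmetric_seq K -> {subset K0 <= K} ->
  \int[mu]_x (f x - partial_sum K f x) ^+ 2 <= \int[mu]_x (f x - p x) ^+ 2.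
Proof.
move=> Tp; have [K0 h] := Rintegral_sub_partial_sum_trig Tp.
exists K0 => K f fL sK K0K; have pL := trigpoly_Lae Tp; have PL := partial_sum_Lae K f.
have rL := LaeB fL PL; have qL := LaeB PL pL.
have r2 := Lae_sqr rL; have q2 := Lae_sqr qL.
have rP := LaeM rL PL; have rp := LaeM rL pL.
have -> : \int[mu]_x (f x - p x) ^+ 2 = \int[mu]_x (f x - partial_sum K f x) ^+ 2 +
    (\int[mu]_x (partial_sum K f x - p x) ^+ 2 +
    2 * (\int[mu]_x ((f x - partial_sum K f x) * partial_sum K f x) -
         \int[mu]_x ((f x - partial_sum K f x) * p x))).
  rewrite -Rintegral_aeB// -Rintegral_aeZ; last first.
    by apply: Lae_eq (LaeM rL qL); apply: aeW => x; rewrite mulrBr.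
  have rq : Lae mu 1 (fun x => 2 * ((f x - partial_sum K f x) * partial_sum K f x -
         (f x - partial_sum K f x) * p x)).
    by apply: LaeZ => //; apply: Lae_eq (LaeM rL qL); apply: aeW => x; rewrite mulrBr.
  rewrite -Rintegral_aeD// -Rintegral_aeD//; last exact: LaeD.
  by apply: eq_Rintegral => x _; ring.
rewrite Rintegral_sub_partial_sum_self// h// subrr mulr0 addr0 lerDl.
by apply: Rintegral_ae_ge0; apply: aeW => x; exact: sqr_ge0.
Qed.

Lemma young (t : R) f g : 0 < t -> Lae mu 2%:E f -> Lae mu 2%:E g ->
  `|\int[mu]_x (f x * g x)| <=
  2^-1 * (t^-1 * \int[mu]_x (f x) ^+ 2 + t * \int[mu]_x (g x) ^+ 2).
Proof.
move=> t0 fL gL; have f2 := Lae_sqr fL; have g2 := Lae_sqr gL.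
have fg := LaeM fL gL.
have hL : Lae mu 1 (fun x => 2^-1 * (t^-1 * f x ^+ 2 + t * g x ^+ 2)).
  by apply: LaeZ => //; apply: LaeD => //; exact: LaeZ.
have hE : \int[mu]_x (2^-1 * (t^-1 * f x ^+ 2 + t * g x ^+ 2)) =
    2^-1 * (t^-1 * \int[mu]_x (f x) ^+ 2 + t * \int[mu]_x (g x) ^+ 2).
  rewrite Rintegral_aeZ; last by apply: LaeD => //; exact: LaeZ.
  by rewrite Rintegral_aeD ?Rintegral_aeZ//; exact: LaeZ.
(* Expansion of (x - s t y)^2 / t >= 0. The signs s = 1 and s = -1 give the two halves of the
   absolute value bound. *)
have key (s x : R) (y : R) : s ^+ 2 = 1 -> s * (x * y) <= 2^-1 * (t^-1 * x ^+ 2 + t * y ^+ 2).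
  move=> s1; have : 0 <= t^-1 * (x - s * t * y) ^+ 2 by rewrite mulr_ge0 ?sqr_ge0// ltW// invr_gt0.
  have -> : t^-1 * (x - s * t * y) ^+ 2 = t^-1 * x ^+ 2 - 2 * s * (x * y) + s ^+ 2 * t * y ^+ 2.
    by field; rewrite gt_eqF.
  by rewrite s1; lra.
rewrite ler_norml -hE; apply/andP; split.
  rewrite lerNl -mulN1r -Rintegral_aeZ//; apply: le_Rintegral_ae => //; first exact: LaeZ.
  by apply: aeW => x; apply: key; rewrite sqrrN expr1n.
apply: le_Rintegral_ae => //; apply: aeW => x; rewrite -[leLHS]mul1r.
by apply: key; rewrite expr1n.
Qed.

Lemma symmetric_closure (K0 : seq index) : exists K, symmetric_seq K /\ {subset K0 <= K}.
Proof.
exists (undup (K0 ++ map -%R K0)); split; last first.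
  by move=> k kK; rewrite mem_undup mem_cat kK.
split; first exact: undup_uniq.
move=> k; rewrite !mem_undup !mem_cat => /orP[kK|/mapP[l lK ->]].
  by rewrite map_f ?orbT.
by rewrite opprK lK.
Qed.

(** One finite K serves all components. The partial sums paired with [G] cancel after the sums over
    components and frequencies are exchanged, since the hypothesis holds frequency by frequency;
    what remains is the pairing of [G] with small remainders. *)
Theorem parseval_orthogonal m (F G : 'I_m -> point -> R) :
  (forall a, Lae mu 2%:E (F a)) -> (forall a, Lae mu 2%:E (G a)) ->
  (forall k, \sum_(a < m) (Ccoef (F a) k * Ccoef (G a) k +
                           Scoef (F a) k * Scoef (G a) k) = 0) ->
  \sum_(a < m) \int[mu]_x (F a x * G a x) = 0.
Proof.
move=> FL GL FG; apply/eqP; rewrite -normr_le0; apply/ler_addgt0Pr => e e0.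
rewrite add0r; pose g2 := \sum_(a < m) \int[mu]_x (G a x) ^+ 2.
have g20 : 0 <= g2.
  by apply: sumr_ge0 => a _; apply: Rintegral_ae_ge0; apply: aeW => x; exact: sqr_ge0.
(* With squared remainders at most t^2, [young] bounds each component by t + t |G_a|^2. The total t
   (m + g2) is at most e, and the added 1 keeps the denominator positive. *)
pose t := e / (m%:R + g2 + 1).
have D0 : 0 < m%:R + g2 + 1 by rewrite ltr_wpDl// addr_ge0.
have t0 : 0 < t by rewrite divr_gt0.
have /choice[K0 hK0] a : exists K0 : seq index, forall K, symmetric_seq K ->
    {subset K0 <= K} -> \int[mu]_x (F a x - partial_sum K (F a) x) ^+ 2 <= t ^+ 2.
  have [p Tp /ltW fp] := trigpoly_dense (FL a) (exprn_gt0 2 t0).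
  have [K0 h] := partial_sum_best_approx Tp.
  by exists K0 => K sK K0K; apply: le_trans fp; exact: h.
have [K [sK K0K]] := symmetric_closure (flatten [seq K0 a | a <- enum 'I_m]).
have rL a : Lae mu 2%:E (fun x => F a x - partial_sum K (F a) x).
  exact: LaeB (partial_sum_Lae K (F a)).
have -> : \sum_(a < m) \int[mu]_x (F a x * G a x) =
    \sum_(a < m) \int[mu]_x ((F a x - partial_sum K (F a) x) * G a x).
  have P0 : \sum_(a < m) \int[mu]_x (partial_sum K (F a) x * G a x) = 0.
    under eq_bigr do rewrite Rintegral_partial_sum//.
    by rewrite exchange_big /= big1.
  transitivity (\sum_(a < m) (\int[mu]_x (partial_sum K (F a) x * G a x) +
      \int[mu]_x ((F a x - partial_sum K (F a) x) * G a x))); last first.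
    by rewrite big_split /= P0 add0r.
  apply: eq_bigr => a _.
  rewrite -Rintegral_aeD; [|exact: LaeM (partial_sum_Lae K (F a)) (GL a)|exact: LaeM].
  by apply: eq_Rintegral => x _; ring.
rewrite (le_trans (ler_norm_sum _ _ _))//.
apply: (@le_trans _ _ (\sum_(a < m) (t + t * \int[mu]_x (G a x) ^+ 2))).
  apply: ler_sum => a _; rewrite (le_trans (young t0 (rL a) (GL a)))//.
  have G0 : 0 <= \int[mu]_x (G a x) ^+ 2.
    by apply: Rintegral_ae_ge0; apply: aeW => x; exact: sqr_ge0.
  have r2 : \int[mu]_x (F a x - partial_sum K (F a) x) ^+ 2 <= t ^+ 2.
    apply: hK0 => // k kK; apply: K0K; apply/flattenP; exists (K0 a) => //.
    by apply: map_f; rewrite mem_enum.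
  have r20 : t^-1 * \int[mu]_x (F a x - partial_sum K (F a) x) ^+ 2 <= t.
    by rewrite ler_pdivrMl// -expr2.
  have : 0 <= t * \int[mu]_x (G a x) ^+ 2 by rewrite mulr_ge0// ltW.
  lra.
rewrite big_split /= sumr_const card_ord -mulr_sumr -/g2 -mulr_natr -mulrDr.
by rewrite /t -mulrA ger_pMr// mulrC ler_pdivrMr// mul1r lerDl.
Qed.

End fourier_projection.

(** * Quadratic forms *)

Section quadratic_forms.
Context {R : realType} {d : nat}.
Local Notation vec := 'cV[R]_d.
Local Notation mat := 'M[R]_d.
Implicit Types (u v w : vec) (L M : mat).

Lemma dotvE u v : dotv u v = (u^T *m v) 0 0.
Proof. by rewrite mxE; apply: eq_bigr => a _; rewrite mxE. Qed.

Lemma dotvC u v : dotv u v = dotv v u.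
Proof. by apply: eq_bigr => a _; rewrite mulrC. Qed.

Lemma dotvDl u v w : dotv (u + v) w = dotv u w + dotv v w.
Proof. by rewrite !dotvE linearD mulmxDl mxE. Qed.

Lemma dotvDr u v w : dotv w (u + v) = dotv w u + dotv w v.
Proof. by rewrite dotvC dotvDl !(dotvC w). Qed.

Lemma dotvNl u w : dotv (- u) w = - dotv u w.
Proof. by rewrite !dotvE linearN mulNmx mxE. Qed.

Lemma dotvNr u w : dotv w (- u) = - dotv w u.
Proof. by rewrite dotvC dotvNl dotvC. Qed.

Lemma dotvZl c u w : dotv (c *: u) w = c * dotv u w.
Proof. by rewrite !dotvE linearZ -scalemxAl mxE. Qed.

Lemma dotvZr c u w : dotv w (c *: u) = c * dotv w u.
Proof. by rewrite dotvC dotvZl dotvC. Qed.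

Lemma dotv_mxl M u v : dotv (M *m u) v = dotv u (M^T *m v).
Proof. by rewrite !dotvE trmx_mul mulmxA. Qed.

Lemma dotv0 u : dotv u 0 = 0.
Proof. by rewrite dotvE mulmx0 mxE. Qed.

Lemma dotv_ge0 u : 0 <= dotv u u.
Proof. by apply: sumr_ge0 => a _; rewrite -expr2 sqr_ge0. Qed.

Lemma coord_le_dotv u a : u a 0 ^+ 2 <= dotv u u.
Proof.
rewrite /dotv (bigD1 a)//= -expr2 lerDl; apply: sumr_ge0 => b _.
by rewrite -expr2 sqr_ge0.
Qed.

Lemma dotv_gt0 u : u != 0 -> 0 < dotv u u.
Proof.
move=> u0; rewrite lt_neqAle dotv_ge0 andbT eq_sym; apply: contraNneq u0 => uu0.
apply/eqP/matrixP => a b; rewrite ord1 mxE; apply/eqP.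
by rewrite -sqrf_eq0 eq_le sqr_ge0 andbT -uu0 coord_le_dotv.
Qed.

Lemma dotv_delta u a : dotv (delta_mx a 0) u = u a 0.
Proof.
rewrite /dotv (bigD1 a)//= mxE !eqxx mul1r big1 ?addr0// => b /negbTE ba.
by rewrite mxE ba mul0r.
Qed.

Lemma qform_scalar c u : qform c%:M u = c * dotv u u.
Proof. by rewrite /qform mul_scalar_mx dotvZl. Qed.

Lemma qformB M u v : symm M ->
  qform M (u - v) = qform M u - 2 * dotv (M *m u) v + qform M v.
Proof.
move=> sM; rewrite /qform mulmxBr dotvDl dotvNl !dotvDr !dotvNr.
by rewrite (_ : dotv (M *m v) u = dotv (M *m u) v); [ring|rewrite dotv_mxl sM dotvC].
Qed.

Definition posdef M := forall u, u != 0 -> 0 < qform M u.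

Lemma posdef_ge0 M u : posdef M -> 0 <= qform M u.
Proof.
by move=> pM; have [->|/pM/ltW//] := eqVneq u 0; rewrite /qform mulmx0 dotv0.
Qed.

Lemma posdef_unit M : posdef M -> M \in unitmx.
Proof.
move=> pM; rewrite unitmxE unitfE; apply/negP => /det0P[v v0 vM].
have : 0 < qform M v^T.
  by apply: pM; rewrite -(inj_eq trmx_inj) trmxK linear0.
by rewrite /qform dotvC dotvE trmxK mulmxA vM mul0mx mxE ltxx.
Qed.

Lemma posdef_lower c M : 0 < c -> (forall u, c * dotv u u <= qform M u) -> posdef M.
Proof. by move=> c0 cM u u0; rewrite (lt_le_trans _ (cM u))// mulr_gt0// dotv_gt0. Qed.

Lemma posdef_le L M : posdef L -> loewner L M -> posdef M.
Proof. by move=> pL LM u u0; exact: lt_le_trans (pL u u0) (LM u). Qed.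

(** Expansion of the nonnegative form of M at M^-1 v - u. *)
Lemma young_mx M u v : symm M -> posdef M ->
  2 * dotv u v <= qform M u + qform (invmx M) v.
Proof.
move=> sM pM; have uM := posdef_unit pM.
have := posdef_ge0 (invmx M *m v - u) pM.
rewrite qformB// mulmxA mulmxV// mul1mx /qform mulmxA mulmxV// mul1mx.
rewrite (dotvC v u) (dotvC v) ; lra.
Qed.

(** Put w = M^-1 u, so that M w . w = w . u = M^-1 u . u. Then 2 w . u <= L w . w + L^-1 u . u <= M
    w . w + L^-1 u . u, and one copy of w . u cancels. *)
Lemma loewner_inv L M : symm L -> posdef L -> loewner L M ->
  loewner (invmx M) (invmx L).
Proof.
move=> sL pL LM u; have uM := posdef_unit (posdef_le pL LM).
have := young_mx (invmx M *m u) u sL pL.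
have := LM (invmx M *m u); rewrite {2}/qform mulmxA mulmxV// mul1mx.
rewrite [qform (invmx M) u]/qform (dotvC u); lra.
Qed.

Lemma symm_inv M : symm M -> symm (invmx M).
Proof. by rewrite /symm trmx_inv => ->. Qed.

Lemma loewner_anti L M : symm L -> symm M -> loewner L M -> loewner M L -> L = M.
Proof.
move=> sL sM LM ML; have q u : qform L u = qform M u.
  by apply/eqP; rewrite eq_le LM ML.
have dq u v : dotv (L *m u) v = dotv (M *m u) v.
  have := q (u - v); rewrite !qformB// !q; lra.
apply/matrixP => a b; have := dq (delta_mx b 0) (delta_mx a 0).
by rewrite ![dotv (_ *m _) _]dotvC !dotv_delta -!colE !mxE.
Qed.

(** Column b of the inverse is w with M w = e_b, so c |w|^2 <= M w . w = w_b <= |w| and |w| <= 1/c.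
    The argument runs on squares, which avoids square roots. *)
Lemma inv_entry_bound c M a b : 0 < c -> (forall u, c * dotv u u <= qform M u) ->
  `|invmx M a b| <= c^-1.
Proof.
move=> c0 cM; have uM := posdef_unit (posdef_lower c0 cM).
pose w : vec := invmx M *m delta_mx b 0.
have wa : w a 0 = invmx M a b by rewrite /w -colE mxE.
have h1 := cM w; move: h1.
rewrite /w /qform mulmxA mulmxV// mul1mx dotv_delta -/w => h1.
have h2 := coord_le_dotv w b; have h3 := coord_le_dotv w a.
have s0 := dotv_ge0 w; rewrite -wa.
have h4 : (c * dotv w w) ^+ 2 <= dotv w w.
  apply: le_trans h2; rewrite ler_pXn2r ?nnegrE ?mulr_ge0 ?(ltW c0)//.
  by rewrite (le_trans _ h1)// mulr_ge0// ltW.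
have h5 : dotv w w <= c^-1 ^+ 2.
  have [->|sn] := eqVneq (dotv w w) 0; first exact: sqr_ge0.
  have sp : 0 < dotv w w by rewrite lt_neqAle eq_sym sn.
  rewrite exprVn -[leRHS]mul1r ler_pdivlMr ?exprn_gt0//.
  by rewrite -(ler_pM2l sp) mulr1 mulrA -expr2 mulrC -exprMn.
rewrite -(ler_pXn2r (n := 2))// ?nnegrE ?invr_ge0 ?(ltW c0)//.
by rewrite real_normK ?num_real// (le_trans h3).
Qed.

End quadratic_forms.

(** * Energies *)

Section fields.
Context {R : realType} {d : nat}.
Local Notation point := (d.-tuple R).
Local Notation vec := 'cV[R]_d.
Local Notation mu := (cell_measure R d).
Implicit Types (u v w e j : point -> vec) (A B : point -> 'M[R]_d) (E J : vec).

Definition L2field v := forall a, Lae mu 2%:E (fun x => v x a 0).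
Definition Linffield A := forall a b, Lae mu +oo (fun x => A x a b).

Lemma L2fieldD u v : L2field u -> L2field v -> L2field (fun x => u x + v x).
Proof.
move=> uL vL a; under eq_fun do rewrite mxE.
by apply: LaeD; [rewrite lee_fin ler1n|exact: uL|exact: vL].
Qed.

Lemma L2fieldZ c u : L2field u -> L2field (fun x => c *: u x).
Proof.
move=> uL a; under eq_fun do rewrite mxE.
by apply: LaeZ; [rewrite ler1n|exact: uL].
Qed.

Lemma L2field_cst E : L2field (fun=> E).
Proof. by move=> a; exact: Lae_cst. Qed.

Lemma L2field_mul A v : Linffield A -> L2field v -> L2field (fun x => A x *m v x).
Proof.
move=> AL vL a; under eq_fun do rewrite mxE.
by apply: Lae_sum => [|b]; [rewrite ler1n|exact: LaeyM].
Qed.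

Lemma dotv_Lae u v : L2field u -> L2field v -> Lae mu 1 (fun x => dotv (u x) (v x)).
Proof. by move=> uL vL; apply: Lae_sum => // a; exact: LaeM. Qed.

Definition ip u v := \int[mu]_x dotv (u x) (v x).

Lemma ipC u v : ip u v = ip v u.
Proof. by apply: eq_Rintegral => x _; rewrite dotvC. Qed.

Lemma ip_sum u v : L2field u -> L2field v ->
  ip u v = \sum_(a < d) \int[mu]_x (u x a 0 * v x a 0).
Proof. by move=> uL vL; rewrite -Rintegral_ae_sum// => a; exact: LaeM. Qed.

Lemma ipDl u v w : L2field u -> L2field v -> L2field w ->
  ip (fun x => u x + v x) w = ip u w + ip v w.
Proof.
move=> uL vL wL; rewrite -Rintegral_aeD; [|exact: dotv_Lae|exact: dotv_Lae].
by apply: eq_Rintegral => x _; rewrite dotvDl.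
Qed.

Lemma ipDr u v w : L2field u -> L2field v -> L2field w ->
  ip w (fun x => u x + v x) = ip w u + ip w v.
Proof. by move=> uL vL wL; rewrite ipC ipDl// !(ipC _ w). Qed.

Lemma ip_cst E J : ip (fun=> E) (fun=> J) = dotv E J.
Proof. exact: Rintegral_cell_cst. Qed.

Definition mean0 v := forall a, \int[mu]_x v x a 0 = 0.

Lemma Lae1_coord v a : L2field v -> Lae mu 1 (fun x => v x a 0).
Proof.
move=> vL; apply: Lae_eq (LaeM (vL a) (Lae_cst mu 2 1)).
by apply: aeW => x; rewrite mulr1.
Qed.

Lemma ip_cst_mean0 E v : L2field v -> mean0 v -> ip (fun=> E) v = 0.
Proof.
move=> vL v0; rewrite ip_sum//; last exact: L2field_cst.
rewrite big1// => a _; rewrite Rintegral_aeZ ?v0 ?mulr0//.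
exact: Lae1_coord.
Qed.

Lemma energyE A E e :
  energy (bform A) E e = ip (fun x => A x *m (E + e x)) (fun x => E + e x).
Proof. by []. Qed.

Lemma energy_Lae A E e : Linffield A -> L2field e ->
  Lae mu 1 (fun x => qform (A x) (E + e x)).
Proof.
move=> AL eL; apply: dotv_Lae; last exact: L2fieldD (L2field_cst E) eL.
exact: L2field_mul AL (L2fieldD (L2field_cst E) eL).
Qed.

Lemma le_energy A B E e : Linffield A -> Linffield B -> L2field e ->
  {ae mu, forall x, loewner (A x) (B x)} ->
  energy (bform A) E e <= energy (bform B) E e.
Proof.
move=> AL BL eL AB; apply: le_Rintegral_ae; [exact: energy_Lae|exact: energy_Lae|].
by apply: filterS AB => x /(_ (E + e x)).
Qed.

(** The zero mean removes the cross terms, so the mean of |E + e|^2 is |E|^2 plus the mean of |e|^2.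
    This coercivity bounds the infima below and makes the dual matrices positive definite. *)
Lemma energy_lower A c E e : 0 <= c -> Linffield A -> L2field e -> mean0 e ->
  {ae mu, forall x, forall v : vec, c * dotv v v <= qform (A x) v} ->
  c * dotv E E <= energy (bform A) E e.
Proof.
move=> c0 AL eL e0 cA; have EL := L2field_cst E.
have DL := L2fieldD EL eL.
apply: (@le_trans _ _ (\int[mu]_x (c * dotv (E + e x) (E + e x)))).
  rewrite Rintegral_aeZ; last exact: dotv_Lae.
  rewrite ler_wpM2l// -[X in _ <= X]/(ip (fun x => E + e x) (fun x => E + e x)).
  rewrite ipDl// !ipDr// ip_cst (ipC e) !ip_cst_mean0// addr0 add0r lerDl.
  by apply: Rintegral_ae_ge0; apply: aeW => x; exact: dotv_ge0.
apply: le_Rintegral_ae; [|exact: energy_Lae|].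
  by apply: LaeZ => //; exact: dotv_Lae.
by apply: filterS cA => x /(_ (E + e x)).
Qed.

Lemma measurable_mxinv (g : point -> 'M[R]_d) a b :
  (forall a b, measurable_fun setT (fun x => g x a b)) ->
  measurable_fun setT (fun x => (\det (g x))^-1 * (\adj (g x)) a b).
Proof.
(* Stated for matrices of every size, as it is applied both to the full determinant and to the
   minors in the adjugate. *)
move=> mg; have mdet n (h : point -> 'M[R]_n) :
    (forall a b, measurable_fun setT (fun x => h x a b)) ->
    measurable_fun setT (fun x => \det (h x)).
  move=> mh; apply: measurable_sum => s; apply: measurable_funM => //.
  by apply: measurable_prod => i _.
apply: measurable_funM.
  (* 1/t = t (t^2)^-1, as the library has the measurability of real powers of
     nonnegative numbers but not of the inverse. *)
  rewrite (_ : (fun _ => _) = fun x => \det (g x) * (\det (g x) ^+ 2) `^ (-1)).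
    apply: measurable_funM; first exact: mdet.
    apply: (measurableT_comp (measurable_powR _)).
    by apply: measurable_funX; exact: mdet.
  apply/funext => x; rewrite powR_inv1 ?sqr_ge0//.
  have [->|d0] := eqVneq (\det (g x)) 0; first by rewrite invr0 mul0r.
  by field.
under eq_fun do rewrite mxE /cofactor.
apply: measurable_funM => //; apply: mdet => i k.
by under eq_fun do rewrite !mxE; exact: mg.
Qed.

(** The matrix [G] of Borel representatives of the entries agrees with [A] a.e.; Cramer's rule for
    [G] gives a Borel representative of the inverse, and ellipticity bounds its entries by 1/c. *)
Lemma Linffield_inv A c : 0 < c -> Linffield A ->
  {ae mu, forall x, forall v : vec, c * dotv v v <= qform (A x) v} ->
  Linffield (inv_field A).
Proof.
move=> c0 AL cA a b.
have /choice[g hg] (ab : 'I_d * 'I_d) : exists g : point -> R,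
    measurable_fun setT g /\ {ae mu, forall x, A x ab.1 ab.2 = g x}.
  have [g gL Ag] := AL ab.1 ab.2; exists g; split => //.
  exact: Lfun_measurable gL.
pose G x : 'M[R]_d := \matrix_(i, k) g (i, k) x.
have AG : {ae mu, forall x, A x = G x}.
  have : {ae mu, forall x, forall ab, A x ab.1 ab.2 = g ab x}.
    by apply: filter_forall => ab; have [] := hg ab.
  apply: filterS => x h; apply/matrixP => i k; rewrite mxE.
  exact: (h (i, k)).
apply: (@bounded_Laey _ _ _ _ c^-1 _ (fun x => (\det (G x))^-1 * (\adj (G x)) a b)).
- apply: measurable_mxinv => i k; under eq_fun do rewrite mxE.
  by have [] := hg (i, k).
- apply: filterS2 AG cA => x <- cAx.
  have uA := posdef_unit (posdef_lower c0 cAx).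
  by rewrite /inv_field /invmx uA mxE.
- by apply: filterS cA => x cAx; exact: inv_entry_bound.
Qed.

(** Nonnegativity of the energies supplies the lower bound without which the real [inf] would be a
    default value; the next lemma likewise takes a member [e0] to exclude the empty set. *)
Lemma homog_inf_le A (S : set (point -> vec)) M E e :
  homog_inf (bform A) S M -> (forall E e, S e -> 0 <= energy (bform A) E e) ->
  S e -> qform M E <= energy (bform A) E e.
Proof.
move=> [_ ->] A0 Se; apply: ge_inf; last by exists e.
by exists 0 => _ [e' Se' <-]; exact: A0.
Qed.

Lemma le_homog_inf A (S : set (point -> vec)) M E e0 (m : R) :
  homog_inf (bform A) S M -> S e0 ->
  (forall e, S e -> m <= energy (bform A) E e) -> m <= qform M E.
Proof.
move=> [_ ->] Se0 mS; apply: lb_le_inf; first by exists (energy (bform A) E e0), e0.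
by move=> _ [e Se <-]; exact: mS.
Qed.

End fields.

(** * The spaces of gradient and of divergence-free fields *)

Section helmholtz.
Context {R : realType} {d : nat}.
Local Notation point := (d.-tuple R).
Local Notation vec := 'cV[R]_d.
Local Notation index := 'cV[int]_d.
Local Notation mu := (cell_measure R d).
Implicit Types (u v w e j : point -> vec) (A B : point -> 'M[R]_d) (E J : vec).
Implicit Types (k l : index).
Local Open Scope complex_scope.

Definition Cf v k a : R := Ccoef (fun x => v x a 0) k.
Definition Sf v k a : R := Scoef (fun x => v x a 0) k.

Lemma fourierE v k a : L2field v ->
  fourier v k a 0 = Cf v k a +i* (- Sf v k a).
Proof.
move=> vL; rewrite mxE /cintegral /phi; congr (_ +i* _).
  by apply: eq_Rintegral => x _ /=; rewrite phaseN cosN /cosk; ring.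
rewrite -mulN1r -Rintegral_aeZ; last exact: LaeM (vL a) (sink_Lae k).
by apply: eq_Rintegral => x _ /=; rewrite phaseN sinN /sink; ring.
Qed.

Lemma complex_eq0 (x y : R) : x +i* y = 0 <-> x = 0 /\ y = 0.
Proof. by split=> [[-> ->]|[-> ->]]. Qed.

Lemma complex_intM (z : int) (x y : R) :
  z%:~R * (x +i* y) = (z%:~R * x) +i* (z%:~R * y) :> R[i].
Proof. by rewrite -(rmorph_int (real_complex R)); simpc. Qed.

Lemma complex_sum I (s : seq I) (x y : I -> R) :
  \sum_(i <- s) (x i +i* y i) = (\sum_(i <- s) x i) +i* (\sum_(i <- s) y i) :> R[i].
Proof.
elim: s => [|i s IH]; first by rewrite !big_nil.
by rewrite !big_cons IH; simpc.
Qed.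

Lemma Sf0 v a : Sf v 0 a = 0.
Proof.
rewrite /Sf /Scoef; under eq_Rintegral do rewrite /sink phase0 sin0 mulr0.
exact: Rintegral_cell_cst.
Qed.

Lemma Cf0 v a : Cf v 0 a = \int[mu]_x v x a 0.
Proof. by apply: eq_Rintegral => x _; rewrite cosk0 mulr1. Qed.

Lemma fourier0P v : L2field v -> fourier v 0 = 0 <-> mean0 v.
Proof.
move=> vL; split=> [f0 a|m0].
  have : fourier v 0 a 0 = 0 by rewrite f0 mxE.
  by rewrite fourierE// => /complex_eq0[]; rewrite Cf0.
apply/matrixP => a b; rewrite ord1 fourierE// Sf0 oppr0 Cf0 m0 mxE.
exact/complex_eq0.
Qed.

Lemma curl_freeP v : L2field v -> curl_free v <->
  forall k a b, (k b 0)%:~R * Cf v k a = (k a 0)%:~R * Cf v k b /\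
                (k b 0)%:~R * Sf v k a = (k a 0)%:~R * Sf v k b.
Proof.
move=> vL; split=> [cv k a b|cv k a b].
  have := cv k a b; rewrite !fourierE// !complex_intM.
  move/subr0_eq => -[-> h]; split => //.
  by apply: oppr_inj; rewrite -!mulrN.
rewrite !fourierE// !complex_intM; have [-> h] := cv k a b.
by rewrite !mulrN h subrr.
Qed.

Lemma div_freeP v : L2field v -> div_free v <->
  forall k, \sum_(a < d) (k a 0)%:~R * Cf v k a = 0 /\
            \sum_(a < d) (k a 0)%:~R * Sf v k a = 0.
Proof.
move=> vL; split=> dv k.
  have := dv k; under eq_bigr do rewrite fourierE// complex_intM.
  rewrite complex_sum => /complex_eq0[-> h]; split => //.
  by move: h; under eq_bigr do rewrite mulrN; rewrite sumrN => /eqP; rewrite oppr_eq0 => /eqP.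
under eq_bigr do rewrite fourierE// complex_intM.
rewrite complex_sum; apply/complex_eq0; have [-> h] := dv k; split => //.
by under eq_bigr do rewrite mulrN; rewrite sumrN h oppr0.
Qed.

Lemma EspP v : Esp v <-> [/\ Defs.periodic v, L2field v, mean0 v &
  forall k a b, (k b 0)%:~R * Cf v k a = (k a 0)%:~R * Cf v k b /\
                (k b 0)%:~R * Sf v k a = (k a 0)%:~R * Sf v k b].
Proof.
split=> [[[pv vL] f0 cv]|[pv vL m0 cv]].
  by split => //; [exact/fourier0P|exact/curl_freeP].
by split => //; [exact/fourier0P|exact/curl_freeP].
Qed.

Lemma JspP v : Jsp v <-> [/\ Defs.periodic v, L2field v, mean0 v &
  forall k, \sum_(a < d) (k a 0)%:~R * Cf v k a = 0 /\
            \sum_(a < d) (k a 0)%:~R * Sf v k a = 0].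
Proof.
split=> [[[pv vL] f0 cv]|[pv vL m0 cv]].
  by split => //; [exact/fourier0P|exact/div_freeP].
by split => //; [exact/fourier0P|exact/div_freeP].
Qed.

Lemma parallel_orthogonal k (f g : 'I_d -> R) : k != 0 ->
  (forall a b, (k b 0)%:~R * f a = (k a 0)%:~R * f b) ->
  \sum_(a < d) (k a 0)%:~R * g a = 0 -> \sum_(a < d) f a * g a = 0.
Proof.
move=> k0 kf kg.
have [b kb] : exists b, k b 0 != 0.
  apply/existsP; apply: contraR k0; rewrite negb_exists => /forallP h.
  by apply/eqP/matrixP => a b; rewrite ord1 mxE; apply/eqP; have := h a; rewrite negbK.
have kbR : (k b 0)%:~R != 0 :> R by rewrite intr_eq0.
apply: (mulfI kbR); rewrite mulr0 mulr_sumr.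
rewrite (eq_bigr (fun a => f b * ((k a 0)%:~R * g a))); last first.
  by move=> a _; rewrite mulrA kf; ring.
by rewrite -mulr_sumr kg mulr0.
Qed.

(** At each frequency k != 0 the coefficients of [e] are parallel to k and those of [j]
    perpendicular to k; at k = 0 the mean and the sine coefficient of [e] vanish. *)
Lemma Esp_Jsp_orthogonal e j : Esp e -> Jsp j -> ip e j = 0.
Proof.
move=> /EspP[_ eL e0 ecurl] /JspP[_ jL j0 jdiv].
rewrite ip_sum//; apply: (parseval_orthogonal (F := fun a x => e x a 0)
  (G := fun a x => j x a 0)) => // k.
rewrite big_split /=; have [->|k0] := eqVneq k 0.
  rewrite !big1 ?addr0// => a _; first by rewrite -/(Sf e 0 a) Sf0 mul0r.
  by rewrite -/(Cf e 0 a) Cf0 e0 mul0r.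
have [jC jS] := jdiv k.
rewrite (parallel_orthogonal k0 _ jC); last by move=> a b; have [] := ecurl k a b.
rewrite (parallel_orthogonal k0 _ jS) ?addr0//.
by move=> a b; have [] := ecurl k a b.
Qed.

Lemma ip_constant_plus E J e j : Esp e -> Jsp j ->
  ip (fun x => E + e x) (fun x => J + j x) = dotv E J.
Proof.
move=> eE jJ; have /EspP[_ eL e0 _] := eE; have /JspP[_ jL j0 _] := jJ.
have EL := L2field_cst E; have JL := L2field_cst J.
rewrite ipDl//; last exact: L2fieldD.
rewrite !ipDr// ip_cst (Esp_Jsp_orthogonal eE jJ).
rewrite (ip_cst_mean0 E jL j0) (ipC e) (ip_cst_mean0 J eL e0).
by rewrite !addr0.
Qed.

Lemma EspD e e' t : Esp e -> Esp e' -> Esp (fun x => e x + t *: e' x).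
Proof.
move=> /EspP[pe eL e0 ec] /EspP[pe' eL' e0' ec']; apply/EspP.
have cE k a : Cf (fun x => e x + t *: e' x) k a = Cf e k a + t * Cf e' k a.
  rewrite -Rintegral_aeZ; last exact: LaeM (eL' a) (cosk_Lae k).
  rewrite -Rintegral_aeD; [|exact: LaeM (eL a) (cosk_Lae k)|]; last first.
    by apply: LaeZ => //; exact: LaeM (eL' a) (cosk_Lae k).
  by apply: eq_Rintegral => x _; rewrite !mxE; ring.
have sE k a : Sf (fun x => e x + t *: e' x) k a = Sf e k a + t * Sf e' k a.
  rewrite -Rintegral_aeZ; last exact: LaeM (eL' a) (sink_Lae k).
  rewrite -Rintegral_aeD; [|exact: LaeM (eL a) (sink_Lae k)|]; last first.
    by apply: LaeZ => //; exact: LaeM (eL' a) (sink_Lae k).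
  by apply: eq_Rintegral => x _; rewrite !mxE; ring.
split.
- by move=> x k; rewrite pe pe'.
- by apply: L2fieldD => //; exact: L2fieldZ.
- by move=> a; rewrite -Cf0 cE !Cf0 e0 e0' mulr0 addr0.
move=> k a b; rewrite !cE !sE !mulrDr; have [-> ->] := ec k a b.
by rewrite !(mulrCA _ t); have [-> ->] := ec' k a b.
Qed.

Lemma cos_sin_2piz (z : int) : cos (2 * pi * z%:~R) = 1 :> R /\ sin (2 * pi * z%:~R) = 0 :> R.
Proof.
have -> : 2 * pi * z%:~R = z%:~R * pi + z%:~R * pi :> R by ring.
rewrite cosD sinD sin_intpi; split; last by ring.
by have := cos2Dsin2 (z%:~R * pi : R); rewrite sin_intpi expr0n addr0 mul0r subr0 -expr2.
Qed.

Lemma phase_shift k x m : exists z : int, phase k (Defs.shift x m) = phase k x + 2 * pi * z%:~R :> R.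
Proof.
exists (\sum_(a < d) k a 0 * m a 0); rewrite /phase -mulrDr; congr (_ * _).
rewrite rmorph_sum -big_split; apply: eq_bigr => a _ /=.
by rewrite tnth_mktuple mulrDr rmorphM.
Qed.

Lemma cosk_shift k x m : cosk k (Defs.shift x m) = cosk k x :> R.
Proof.
have [z zE] := phase_shift k x m; have [c s] := cos_sin_2piz z.
by rewrite /cosk zE cosD c s mulr0 subr0 mulr1.
Qed.

Lemma sink_shift k x m : sink k (Defs.shift x m) = sink k x :> R.
Proof.
have [z zE] := phase_shift k x m; have [c s] := cos_sin_2piz z.
by rewrite /sink zE sinD c s mulr0 addr0 mulr1.
Qed.

(** For g = cos (2 pi k . x) this is the gradient of sin (2 pi k . x) / (2 pi), and for g = sin (2
    pi k . x) that of - cos (2 pi k . x) / (2 pi). *)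
Definition gradient_mode (g : point -> R) k : point -> vec :=
  fun x => g x *: \col_a (k a 0)%:~R.

Lemma Esp_gradient_mode g k : (forall x m, g (Defs.shift x m) = g x) -> Lae mu 2%:E g ->
  (forall l, l != k -> l != - k -> Ccoef g l = 0 /\ Scoef g l = 0) ->
  Esp (gradient_mode g k).
Proof.
move=> pg gL g0; apply/EspP.
have cE l a : Cf (gradient_mode g k) l a = (k a 0)%:~R * Ccoef g l.
  rewrite -Rintegral_aeZ; last exact: LaeM (cosk_Lae l).
  by apply: eq_Rintegral => x _; rewrite !mxE; ring.
have sE l a : Sf (gradient_mode g k) l a = (k a 0)%:~R * Scoef g l.
  rewrite -Rintegral_aeZ; last exact: LaeM (sink_Lae l).
  by apply: eq_Rintegral => x _; rewrite !mxE; ring.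
split.
- by move=> x m; rewrite /gradient_mode pg.
- move=> a; apply: Lae_eq (LaeZ ((k a 0)%:~R) ler12 gL).
  by apply: aeW => x; rewrite !mxE mulrC.
- move=> a; rewrite -Cf0 cE; have [->|k0] := eqVneq k 0; first by rewrite mxE mul0r.
  by have [||-> _] := g0 0; rewrite ?mulr0// eq_sym ?oppr_eq0.
move=> l a b; rewrite !cE !sE; have [->|lk] := eqVneq l k; first by split; ring.
have [->|lNk] := eqVneq l (- k); first by rewrite !mxE !rmorphN /=; split; ring.
by have [-> ->] := g0 l lk lNk; rewrite !mulr0.
Qed.

Lemma Esp_cos_mode k : Esp (gradient_mode (cosk k) k).
Proof.
apply: Esp_gradient_mode; [exact: cosk_shift|exact: cosk_Lae|move=> l lk lNk].
rewrite /Ccoef /Scoef Rintegral_cosk_cosk; split.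
  by rewrite eq_sym eqr_oppLR (negbTE lNk) eq_sym (negbTE lk) !mulr0 addr0.
by under eq_Rintegral do rewrite mulrC; exact: Rintegral_sink_cosk.
Qed.

Lemma Esp_sin_mode k : Esp (gradient_mode (sink k) k).
Proof.
apply: Esp_gradient_mode; [exact: sink_shift|exact: sink_Lae|move=> l lk lNk].
rewrite /Ccoef /Scoef Rintegral_sink_cosk Rintegral_sink_sink; split => //.
by rewrite eq_sym eqr_oppLR (negbTE lNk) eq_sym (negbTE lk) !mulr0 addr0.
Qed.

(** Testing [s] against the cosine and sine gradient modes of frequency k says exactly that k is
    orthogonal to its coefficients there; subtracting the mean changes only frequency 0. *)
Lemma Jsp_of_orthogonal s : Defs.periodic s -> L2field s ->
  (forall e, Esp e -> ip s e = 0) ->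
  Jsp (fun x => s x - \col_a \int[mu]_y s y a 0).
Proof.
move=> ps sL sE; apply/JspP; set J := \col_a _.
have cE k a : Cf (fun x => s x - J) k a = Cf s k a - J a 0 * (k == 0)%:R.
  rewrite -Rintegral_cosk -Rintegral_aeZ; last exact: cosk_Lae1.
  rewrite -Rintegral_aeB; [|exact: LaeM (sL a) (cosk_Lae k)|]; last first.
    by apply: LaeZ => //; exact: cosk_Lae1.
  by apply: eq_Rintegral => x _; rewrite mxE [(- J) a 0]mxE; ring.
have sE' k a : Sf (fun x => s x - J) k a = Sf s k a.
  rewrite -[RHS]subr0 -(mulr0 (J a 0)) -(Rintegral_sink k) -Rintegral_aeZ; last exact: sink_Lae1.
  rewrite -Rintegral_aeB; [|exact: LaeM (sL a) (sink_Lae k)|]; last first.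
    by apply: LaeZ => //; exact: sink_Lae1.
  by apply: eq_Rintegral => x _; rewrite mxE [(- J) a 0]mxE; ring.
have ortho g k : Lae mu 2%:E g -> Esp (gradient_mode g k) ->
    \sum_(a < d) (k a 0)%:~R * \int[mu]_x (s x a 0 * g x) = 0.
  move=> gL /[dup] /EspP[_ mL _ _] /sE; rewrite ip_sum// => h; rewrite -[RHS]h.
  apply: eq_bigr => a _; rewrite -Rintegral_aeZ; last exact: LaeM (sL a) gL.
  by apply: eq_Rintegral => x _; rewrite !mxE; ring.
split.
- by move=> x k; rewrite ps.
- exact: L2fieldD sL (L2field_cst (- J)).
- by move=> a; rewrite -Cf0 cE Cf0 mxE eqxx mulr1 subrr.
move=> k; split.
  rewrite -[RHS](ortho _ _ (cosk_Lae k) (Esp_cos_mode k)); apply: eq_bigr => a _.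
  rewrite cE; have [->|k0] := eqVneq k 0; first by rewrite mxE !mul0r.
  by rewrite mulr0 subr0.
rewrite -[RHS](ortho _ _ (sink_Lae k) (Esp_sin_mode k)); apply: eq_bigr => a _.
by rewrite sE'.
Qed.

End helmholtz.

(** * Duality and the chain of bounds *)

Section duality.
Context {R : realType} {d : nat}.
Local Notation point := (d.-tuple R).
Local Notation vec := 'cV[R]_d.
Local Notation mu := (cell_measure R d).
Implicit Types (u v w e j : point -> vec) (A B : point -> 'M[R]_d) (E J : vec).

Lemma stationary (b q : R) : (forall t, 0 <= 2 * t * b + t ^+ 2 * q) -> b = 0.
Proof.
move=> h; apply/eqP; apply/negPn/negP => b0.
have Q0 : 0 < `|q| + 1 by rewrite ltr_wpDl.
(* A near-minimizer of the quadratic, with |q| + 1 in place of q because q may be zero or negative;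
   the value there is (b / (|q| + 1))^2 (q - 2 (|q| + 1)) < 0. *)
have := h (- b / (`|q| + 1)); apply/negP; rewrite -ltNge.
have -> : 2 * (- b / (`|q| + 1)) * b + (- b / (`|q| + 1)) ^+ 2 * q =
    (b / (`|q| + 1)) ^+ 2 * (q - 2 * (`|q| + 1)).
  by field; rewrite gt_eqF.
have bQ : b / (`|q| + 1) != 0 by rewrite mulf_neq0// invr_eq0 gt_eqF.
rewrite pmulr_rlt0; last by rewrite exprn_even_gt0.
have := ler_norm q; have := normr_ge0 q; lra.
Qed.

Lemma minimizer_orthogonal A E e e' : (forall x, symm (A x)) -> Linffield A ->
  is_minimizer Esp (energy (bform A) E) e -> Esp e' ->
  ip (fun x => A x *m (E + e x)) e' = 0.
Proof.
move=> sA AL [eE emin] eE'.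
have /EspP[_ eL _ _] := eE; have /EspP[_ eL' _ _] := eE'.
have pL := L2fieldD (L2field_cst E) eL.
have ApL := L2field_mul AL pL; have AeL := L2field_mul AL eL'.
apply: (@stationary _ (ip (fun x => A x *m e' x) e')) => t.
have := emin _ (EspD t eE eE'); rewrite -subr_ge0; congr (0 <= _).
have h1 := dotv_Lae ApL pL; have h2 := dotv_Lae ApL eL'; have h3 := dotv_Lae AeL eL'.
have -> : energy (bform A) E (fun x => e x + t *: e' x) =
   energy (bform A) E e + (2 * t * ip (fun x => A x *m (E + e x)) e' +
     t ^+ 2 * ip (fun x => A x *m e' x) e').
  rewrite -!Rintegral_aeZ// -Rintegral_aeD; [|exact: LaeZ|exact: LaeZ].
  rewrite -Rintegral_aeD//; last by apply: LaeD => //; exact: LaeZ.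
  apply: eq_Rintegral => x _; rewrite addrA mulmxDr -scalemxAr.
  move: (E + e x) (e' x) => p f.
  have -> : dotv (A x *m p + t *: (A x *m f)) (p + t *: f) = dotv (A x *m p) p +
      t * dotv (A x *m p) f + t * dotv (A x *m f) p + t * (t * dotv (A x *m f) f).
    by rewrite dotvDl !dotvDr !dotvZl !dotvZr; ring.
  have -> : dotv (A x *m f) p = dotv (A x *m p) f by rewrite dotv_mxl sA dotvC.
  by ring.
by rewrite addrC addKr.
Qed.

Lemma dual_energy_bound A E J e j : (forall x, spd (A x)) -> Linffield A ->
  Linffield (inv_field A) -> Esp e -> Jsp j ->
  2 * dotv E J <= energy (bform A) E e + energy (bform (inv_field A)) J j.
Proof.
move=> pA AL AiL eE jJ; rewrite -(ip_constant_plus E J eE jJ).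
have /EspP[_ eL _ _] := eE; have /JspP[_ jL _ _] := jJ.
have pL := L2fieldD (L2field_cst E) eL; have qL := L2fieldD (L2field_cst J) jL.
have h1 := energy_Lae E AL eL; have h2 := energy_Lae J AiL jL.
rewrite -Rintegral_aeZ; last exact: dotv_Lae.
rewrite -Rintegral_aeD//; apply: le_Rintegral_ae.
- by apply: LaeZ => //; exact: dotv_Lae.
- exact: LaeD.
by apply: aeW => x; have [sAx pAx] := pA x; exact: young_mx.
Qed.

Lemma dual_field A E e : Defs.periodic A -> (forall x, spd (A x)) -> Linffield A ->
  is_minimizer Esp (energy (bform A) E) e -> exists J, exists2 j, Jsp j &
  energy (bform (inv_field A)) J j = energy (bform A) E e /\
  energy (bform A) E e = dotv J E.
Proof.
move=> perA pA AL emin; have /EspP[pe eL e0 _] := emin.1.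
have pL := L2fieldD (L2field_cst E) eL.
pose s x := A x *m (E + e x); have sL : L2field s by exact: L2field_mul.
have sE e' : Esp e' -> ip s e' = 0.
  by apply: minimizer_orthogonal => // x; have [] := pA x.
pose J : vec := \col_a \int[mu]_y s y a 0.
exists J; exists (fun x => s x - J).
  by apply: Jsp_of_orthogonal => // x k; rewrite /s perA pe.
split.
  apply: eq_Rintegral => x _; rewrite addrC subrK /inv_field /s mulmxA mulVmx.
    by rewrite mul1mx dotvC.
  by have [_ pAx] := pA x; exact: posdef_unit.
rewrite energyE ipDr//; last exact: L2field_cst.
rewrite (sE _ emin.1) addr0 ip_sum//; last exact: L2field_cst.
apply: eq_bigr => a _; rewrite mxE mulrC -Rintegral_aeZ; last exact: Lae1_coord.
by apply: eq_Rintegral => x _; rewrite mulrC.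
Qed.

Lemma homogenized_duality A AH BH : Defs.periodic A -> (forall x, spd (A x)) ->
  Linffield A -> Linffield (inv_field A) ->
  homog_min (bform A) Esp AH -> homog_min (bform (inv_field A)) Jsp BH ->
  posdef BH -> invmx BH = AH.
Proof.
move=> perA pA AL AiL [sAH hAH] [sBH hBH] pBH; have uB := posdef_unit pBH.
apply: loewner_anti => //; first exact: symm_inv.
  move=> E; have [e emin ->] := hAH E.
  (* The choice J = BH^-1 E gives E . J = BH J . J = BH^-1 E . E, so the energy bound reduces to
     BH^-1 E . E <= AH E . E. *)
  have [j jmin jE] := hBH (invmx BH *m E).
  have := dual_energy_bound E (invmx BH *m E) pA AL AiL emin.1 jmin.1.
  have qE : qform BH (invmx BH *m E) = dotv E (invmx BH *m E).
    by rewrite /qform mulmxA mulmxV// mul1mx.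
  rewrite -jE qE [qform (invmx BH) E]/qform (dotvC _ E); lra.
move=> E; have [e emin eE] := hAH E; rewrite eE.
(* With m = AH E . E, the dual field yields BH J . J <= m and J . E = m; then 2 J . E <= BH J . J +
   BH^-1 E . E leaves m <= BH^-1 E . E. *)
have [J [j jJ [jE eJ]]] := dual_field perA pA AL emin.
have [j' j'min j'E] := hBH J; have := j'min.2 _ jJ; rewrite -j'E jE.
have := young_mx J E sBH pBH; rewrite eJ; lra.
Qed.

End duality.

Theorem lemma20 (R : realType) (d : nat) (hd : d = 2%N \/ d = 3%N)
  (A Aup Alow : d.-tuple R -> 'M[R]_d) (N : 'I_d -> nat)
  (hA : material A)
  (hN : forall a, odd (N a))
  (hAup : Linfper Aup) (hAlow : Linfper Alow)
  (hAup_symm : {ae cell_measure R d, forall x, symm (Aup x)})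
  (hAlow_symm : {ae cell_measure R d, forall x, symm (Alow x)})
  (hAlow_ell : unif_elliptic Alow)
  (hbounds : {ae cell_measure R d, forall x,
     loewner (Alow x) (A x) /\ loewner (A x) (Aup x)})
  (AH BH AHN BHN : 'M[R]_d)
  (hAH : homog_min (bform A) Esp AH)
  (hBH : homog_min (bform (inv_field A)) Jsp BH)
  (hAHN : homog_inf (bform A) (EN N) AHN)
  (hBHN : homog_inf (bform (inv_field A)) (JN N) BHN)
  (et jt : 'cV[R]_d -> d.-tuple R -> 'cV[R]_d)
  (het : forall E, is_minimizer (EN N) (energy (gni_form N A) E) (et E))
  (hjt : forall J,
     is_minimizer (JN N) (energy (gni_form N (inv_field A)) J) (jt J))
  (AupH BupH AupHN BupHN AtupHN BtupHN : 'M[R]_d)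
  (hAupH : homog_inf (bform Aup) Esp AupH)
  (hBupH : homog_inf (bform (inv_field Alow)) Jsp BupH)
  (hAupHN : homog_inf (bform Aup) (EN N) AupHN)
  (hBupHN : homog_inf (bform (inv_field Alow)) (JN N) BupHN)
  (hAtupHN : homog_at (bform Aup) et AtupHN)
  (hBtupHN : homog_at (bform (inv_field Alow)) jt BtupHN) :
  [/\ loewner (invmx BtupHN) (invmx BupHN),
      loewner (invmx BupHN) (invmx BupH),
      loewner (invmx BupH) (invmx BH),
      invmx BH = AH &
      [/\ loewner AH AupH, loewner AupH AupHN & loewner AupHN AtupHN]] /\
  [/\ loewner (invmx BupHN) (invmx BHN),
      loewner (invmx BHN) (invmx BH),
      invmx BH = AH,
      loewner AH AHN &
      loewner AHN AupHN].
Proof.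
have [[perA AL] pA [c [C [c0 cC cAC]]] _] := hA.
have [_ AupL] := hAup; have [_ AlowL] := hAlow; have [c' c'0 cAlow] := hAlow_ell.
have C0 : 0 < C by exact: lt_le_trans cC.
have cA : {ae cell_measure R d, forall x, forall v : 'cV[R]_d,
    c * dotv v v <= qform (A x) v}.
  by apply: filterS cAC => x h v; have /andP[] := h v.
have AupA : {ae cell_measure R d, forall x, loewner (A x) (Aup x)}.
  by apply: filterS hbounds => x [].
have cAup : {ae cell_measure R d, forall x, forall v : 'cV[R]_d,
    c * dotv v v <= qform (Aup x) v}.
  by apply: filterS2 cA AupA => x h1 h2 v; exact: le_trans (h1 v) (h2 v).
have AiL := Linffield_inv c0 AL cA.
have AlowiL := Linffield_inv c'0 AlowL cAlow.
(* Inverting A <= C gives the lower constant C^-1 of the dual energies. It passes to the inverse of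
   [Alow] because that inverse dominates the inverse of [A]. *)
have AiC : {ae cell_measure R d, forall x, forall v : 'cV[R]_d,
    C^-1 * dotv v v <= qform (inv_field A x) v}.
  apply: filterS cAC => x h v; have [sAx pAx] := pA x.
  rewrite -qform_scalar -invmx_scalar; apply: loewner_inv => // u.
  by rewrite qform_scalar; have /andP[] := h u.
have AiAlowi : {ae cell_measure R d, forall x,
    loewner (inv_field A x) (inv_field Alow x)}.
  apply: filterS3 hAlow_symm cAlow hbounds => x sx cx [AlA _].
  by apply: loewner_inv => //; exact: posdef_lower cx.
have AlowiC : {ae cell_measure R d, forall x, forall v : 'cV[R]_d,
    C^-1 * dotv v v <= qform (inv_field Alow x) v}.
  by apply: filterS2 AiC AiAlowi => x h1 h2 v; exact: le_trans (h1 v) (h2 v).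
have Ci0 : 0 < C^-1 by rewrite invr_gt0.
have EspL (e : d.-tuple R -> 'cV[R]_d) : Esp e -> L2field e by case/EspP.
have JspL (j : d.-tuple R -> 'cV[R]_d) : Jsp j -> L2field j by case/JspP.
have lowE B b E e : 0 < b -> Linffield B -> {ae cell_measure R d, forall x,
    forall v : 'cV[R]_d, b * dotv v v <= qform (B x) v} -> Esp e ->
    b * dotv E E <= energy (bform B) E e.
  by move=> /ltW b0 BL bB /EspP[_ eL e0 _]; exact: energy_lower.
have lowJ B b J j : 0 < b -> Linffield B -> {ae cell_measure R d, forall x,
    forall v : 'cV[R]_d, b * dotv v v <= qform (B x) v} -> Jsp j ->
    b * dotv J J <= energy (bform B) J j.
  by move=> /ltW b0 BL bB /JspP[_ jL j0 _]; exact: energy_lower.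
have posE B b E e : 0 < b -> Linffield B -> {ae cell_measure R d, forall x,
    forall v : 'cV[R]_d, b * dotv v v <= qform (B x) v} -> Esp e ->
    0 <= energy (bform B) E e.
  by move=> b0 BL bB eE; rewrite (le_trans _ (lowE _ _ _ _ b0 BL bB eE))//
    mulr_ge0 ?dotv_ge0// ltW.
have posJ B b J j : 0 < b -> Linffield B -> {ae cell_measure R d, forall x,
    forall v : 'cV[R]_d, b * dotv v v <= qform (B x) v} -> Jsp j ->
    0 <= energy (bform B) J j.
  by move=> b0 BL bB jJ; rewrite (le_trans _ (lowJ _ _ _ _ b0 BL bB jJ))//
    mulr_ge0 ?dotv_ge0// ltW.
(* Membership makes these minimizers admissible in the exact energies, and it shows that all four
   spaces of trial fields are nonempty. *)
have etE E : EN N (et E) by have [] := het E.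
have jtJ J : JN N (jt J) by have [] := hjt J.
have ENE (e : d.-tuple R -> 'cV[R]_d) : EN N e -> Esp e by case.
have JNJ (j : d.-tuple R -> 'cV[R]_d) : JN N j -> Jsp j by case.
have pBH : posdef BH.
  apply: (posdef_lower Ci0) => J; have [j [jJ _] ->] := hBH.2 J.
  exact: lowJ.
have pBHN : posdef BHN.
  apply: (posdef_lower Ci0) => J; apply: (le_homog_inf hBHN (jtJ J)) => j /JNJ.
  exact: lowJ.
have pBupH : posdef BupH.
  apply: (posdef_lower Ci0) => J; apply: (le_homog_inf hBupH (JNJ _ (jtJ J))) => j.
  exact: lowJ.
have pBupHN : posdef BupHN.
  apply: (posdef_lower Ci0) => J; apply: (le_homog_inf hBupHN (jtJ J)) => j /JNJ.
  exact: lowJ.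
have dual : invmx BH = AH by exact: homogenized_duality hAH hBH pBH.
split; split => //.
(* The dual bounds are proved for the matrices before inversion, in the opposite order.
   [loewner_inv] takes positive definiteness of the smaller matrix and transfers it to the larger
   one, here [BtupHN]. *)
- apply: loewner_inv => //; first exact: hBupHN.1.
  move=> J; rewrite hBtupHN.2; apply: (homog_inf_le _ hBupHN) => // J' j /JNJ.
  exact: posJ Ci0 AlowiL AlowiC.
- apply: loewner_inv => //; first exact: hBupH.1.
  move=> J; apply: (le_homog_inf hBupHN (jtJ J)) => j /JNJ jJ.
  by apply: (homog_inf_le _ hBupH) => // J' j'; exact: posJ Ci0 AlowiL AlowiC.
- apply: loewner_inv => //; first exact: hBH.1.
  move=> J; have [j0 [_ j0min] ->] := hBH.2 J.
  apply: (le_homog_inf hBupH (JNJ _ (jtJ J))) => j jJ.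
  by apply: le_trans (j0min _ jJ) _; apply: le_energy => //; exact: JspL.
- split.
  + move=> E; have [e0 [_ e0min] ->] := hAH.2 E.
    apply: (le_homog_inf hAupH (ENE _ (etE E))) => e eE.
    by apply: le_trans (e0min _ eE) _; apply: le_energy => //; exact: EspL.
  + move=> E; apply: (le_homog_inf hAupHN (etE E)) => e /ENE eE.
    by apply: (homog_inf_le _ hAupH) => // E' e'; exact: posE c0 AupL cAup.
  + move=> E; rewrite hAtupHN.2; apply: (homog_inf_le _ hAupHN) => // E' e /ENE.
    exact: posE c0 AupL cAup.
- apply: loewner_inv => //; first exact: hBHN.1.
  move=> J; apply: (le_homog_inf hBupHN (jtJ J)) => j jN; have jJ := JNJ _ jN.
  apply: (@le_trans _ _ (energy (bform (inv_field A)) J j)).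
    by apply: (homog_inf_le _ hBHN) => // J' j' /JNJ; exact: posJ Ci0 AiL AiC.
  by apply: le_energy => //; exact: JspL.
- apply: loewner_inv => //; first exact: hBH.1.
  move=> J; have [j0 [_ j0min] ->] := hBH.2 J.
  by apply: (le_homog_inf hBHN (jtJ J)) => j /JNJ; exact: j0min.
- move=> E; have [e0 [_ e0min] ->] := hAH.2 E.
  by apply: (le_homog_inf hAHN (etE E)) => e /ENE; exact: e0min.
- move=> E; apply: (le_homog_inf hAupHN (etE E)) => e eN; have eE := ENE _ eN.
  apply: (@le_trans _ _ (energy (bform A) E e)).
    by apply: (homog_inf_le _ hAHN) => // E' e' /ENE; exact: posE c0 AL cA.
  by apply: le_energy => //; exact: EspL.
Qed.
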